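(* Let $F$ be a field of characteristic $0$ and let $T_2$ be the mixed trace algebra of two generic $3\times 3$ matrices over $F$. The multiplicity series of the Hilbert series $H(T_2,x,y)$ is \[ M'(H(T_2,x,y))(t,v)=\frac{h_3(v)t^3+h_2(v)t^2+h_1(v)t+h_0(v)} {(1-v)^7(1+v)^4(1+v^2)(1-t)^3(1+t)(1-vt)}, \] where the polynomials $h_i(v)\in F[v]$, $i=0,1,2,3$, are \[ h_3(v)=v^2(v^4-v^3+3v^2-v+1),\quad h_2(v)= v(2v^4-4v^3+v^2-v-1), \] \[ h_1(v)=v(-v^4-v^3+v^2-4v+2), \quad h_0(v)=v^4-v^3+3v^2-v+1. \] It also has the expression \[ M'(H(T_2,x,y))(t,v)=\frac{a_3(v)}{(1-t)^3}+\frac{a_2(v)}{(1-t)^2} +\frac{a_1(v)}{1-t}+\frac{b(v)}{1+t}+\frac{c(v)}{1-vt}, \] where \[ a_3(v)=\frac{1}{2(1-v)^6(1+v)^2},\quad a_2(v)=\frac{3v^2-2v+1}{2^2(1-v)^7(1+v)^3}, \] \[ a_1(v)=\frac{v^4-6v^3+14v^2-6v+1} {2^3(1-v)^8(1+v)^4}, \] \[ b(v)=\frac{1}{2^3(1-v)^2(1+v)^4(1+v^2)}, \quad c(v)=\frac{-v^4}{(1-v)^8(1+v)^4(1+v^2)}. \]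
   Context: Generic matrices: $X_1,X_2$ are $3\times 3$ matrices whose entries are algebraically independent commuting variables over $F$. $R_2$ is the (unital) $F$-algebra generated by $X_1,X_2$; $C_2$ is the pure trace algebra, generated by the traces $\mathrm{tr}(X_{i_1}\cdots X_{i_k})$ of all products; the mixed trace algebra $T_2$ is the algebra generated by $R_2$ and $C_2$, the elements of $C_2$ being regarded as scalar matrices. $T_2$ is graded by multidegree in $(X_1,X_2)$, and its Hilbert series is $H(T_2,x,y)=\sum_{k_1,k_2\ge 0}\dim T_2^{(k_1,k_2)}x^{k_1}y^{k_2}$, where $T_2^{(k_1,k_2)}$ is the homogeneous component of multidegree $(k_1,k_2)$. It is known (Berele and Stembridge) that \[ H(T_2,x,y)=\frac{1}{(1-x)^2(1-y)^2(1-x^2)(1-y^2)(1-xy)^2(1-x^2y)(1-xy^2)}. \] Multiplicity series: every symmetric formal power series $f(x,y)\in F[[x,y]]$ can be written uniquely as $f(x,y)=\sum_{\lambda_1\ge\lambda_2\ge 0}m(\lambda_1,\lambda_2)S_{(\lambda_1,\lambda_2)}(x,y)$ with $m(\lambda_1,\lambda_2)\in F$, where $S_{(\lambda_1,\lambda_2)}(x,y)=(xy)^{\lambda_2}(x^p+x^{p-1}y+\cdots+xy^{p-1}+y^p)$, $p=\lambda_1-\lambda_2$, is the Schur function in two variables. The multiplicity series of $f$ is \[ M'(f)(t,v)=\sum_{\lambda_1\ge\lambda_2\ge 0}m(\lambda_1,\lambda_2)\,t^{\lambda_1-\lambda_2}v^{\lambda_2}\in F[[t,v]]. \] *)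

(* Defs.v *)
From HB Require Import structures.
From mathcomp Require Import all_boot all_order all_algebra.
From mathcomp Require Import boolp.
From mathcomp.multinomials Require Import mpoly.

Set Implicit Arguments.
Unset Strict Implicit.
Unset Printing Implicit Defensive.

Import GRing.Theory.
Local Open Scope ring_scope.

Record fps (R : Type) := Fps { fps_coef :> nat -> R }.

Lemma fpsP (R : Type) (f g : fps R) : (forall n, f n = g n) <-> f = g.
Proof.
split=> [efg | -> //]; case: f g efg => [f] [g] /= efg.
by congr Fps; apply: functional_extensionality_dep.
Qed.

HB.instance Definition _ (R : Type) := gen_eqMixin (fps R).
HB.instance Definition _ (R : Type) := gen_choiceMixin (fps R).

Section FpsZmod.
Variable R : zmodType.
Implicit Types f g h : fps R.

Definition fps_zero : fps R := Fps (fun=> 0).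
Definition fps_opp f : fps R := Fps (fun n => - f n).
Definition fps_add f g : fps R := Fps (fun n => f n + g n).

Fact fps_addA : associative fps_add.
Proof. by move=> f g h; apply/fpsP => n /=; rewrite addrA. Qed.
Fact fps_addC : commutative fps_add.
Proof. by move=> f g; apply/fpsP => n /=; rewrite addrC. Qed.
Fact fps_add0 : left_id fps_zero fps_add.
Proof. by move=> f; apply/fpsP => n /=; rewrite add0r. Qed.
Fact fps_addN : left_inverse fps_zero fps_opp fps_add.
Proof. by move=> f; apply/fpsP => n /=; rewrite addNr. Qed.

HB.instance Definition _ :=
  GRing.isZmodule.Build (fps R) fps_addA fps_addC fps_add0 fps_addN.

End FpsZmod.

Section FpsRing.
Variable R : comNzRingType.
Implicit Types f g h : fps R.

Definition fpsC (c : R) : fps R := Fps (fun n => if n == 0%N then c else 0).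
Definition fpsX : fps R := Fps (fun n => (n == 1%N)%:R).

Definition fps_mul f g : fps R :=
  Fps (fun n => \sum_(i < n.+1) f i * g (n - i)%N).

Fact fps_mulC : commutative fps_mul.
Proof.
move=> f g; apply/fpsP => n /=; rewrite (reindex_inj rev_ord_inj) /=.
by apply: eq_bigr => i _; rewrite subSS mulrC subKn // leq_ord.
Qed.

Fact fps_mulA : associative fps_mul.
Proof.
move=> f g h; apply/fpsP => n; rewrite (fps_mulC (fps_mul f g)) /=.
pose t j k := f j * (g (n - j - k)%N * h k).
transitivity (\sum_(j < n.+1) \sum_(k < n.+1 | (k <= n - j)%N) t j k).
  apply: eq_bigr => /= j _; have /= -> := congr1 (fun u : fps R => u (n - j)%N) (fps_mulC g h).
  rewrite big_distrr /= (big_ord_narrow_leq (leq_subr _ _)).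
  by apply: eq_bigr => k _; rewrite /t /= [h _ * _]mulrC.
rewrite (exchange_big_dep predT) //=; apply: eq_bigr => k _.
transitivity (\sum_(j < n.+1 | (j <= n - k)%N) t j k).
  apply: eq_bigl => j; rewrite -ltnS -(ltnS j) -!subSn ?leq_ord //.
  by rewrite -subn_gt0 -(subn_gt0 j) -!subnDA addnC.
rewrite (big_ord_narrow_leq (leq_subr _ _)) big_distrr /=.
apply: eq_bigr => j _; rewrite /t /= -!subnDA addnC mulrA.
by rewrite [LHS]mulrC.
Qed.

Fact fps_mul1 : left_id (fpsC 1) fps_mul.
Proof.
move=> f; apply/fpsP => n /=; rewrite big_ord_recl /= mul1r subn0.
by rewrite big1 ?addr0 // => i _; rewrite mul0r.
Qed.

Fact fps_mulDl : left_distributive fps_mul +%R.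
Proof.
move=> f g h; apply/fpsP => n /=; rewrite -big_split /=.
by apply: eq_bigr => i _; rewrite mulrDl.
Qed.

Fact fps_one_neq0 : fpsC 1 != 0.
Proof. by apply/eqP => /fpsP/(_ 0%N) /= /eqP; rewrite oner_eq0. Qed.

HB.instance Definition _ := GRing.Zmodule_isComNzRing.Build (fps R)
  fps_mulA fps_mulC fps_mul1 fps_mulDl fps_one_neq0.

Lemma fps_mulE f g n : (f * g) n = \sum_(i < n.+1) f i * g (n - i)%N.
Proof. by []. Qed.

End FpsRing.

Section FpsUnitRing.
Variable R : comUnitRingType.
Implicit Types f g : fps R.

Fixpoint fps_inv_seq f (n : nat) : seq R :=
  if n is n'.+1 then
    let s := fps_inv_seq f n' in
    rcons s (if n' == 0%N then (f 0%N)^-1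
             else - ((f 0%N)^-1 * \sum_(i < n') f i.+1 * s`_(n' - i.+1)))
  else [::].

Definition fps_unit : pred (fps R) := fun f => f 0%N \is a GRing.unit.

Definition fps_inv f : fps R :=
  if fps_unit f then Fps (fun n => (fps_inv_seq f n.+1)`_n) else f.

Lemma size_fps_inv_seq f n : size (fps_inv_seq f n) = n.
Proof. by elim: n => //= n IHn; rewrite size_rcons IHn. Qed.

Lemma nth_fps_inv_seq f n i :
  (i < n)%N -> (fps_inv_seq f n)`_i = (fps_inv_seq f i.+1)`_i.
Proof.
elim: n => // n IHn; rewrite ltnS leq_eqVlt => /orP[/eqP -> // | lt_in].
by rewrite [LHS]nth_rcons size_fps_inv_seq lt_in IHn.
Qed.

Fact fps_mulVr : {in fps_unit, left_inverse 1 fps_inv *%R}.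
Proof.
move=> f Uf; rewrite mulrC; apply/fpsP => n; rewrite fps_mulE /fps_inv.
have Uf' : fps_unit f by []; rewrite Uf' big_ord_recl /= subn0.
rewrite nth_rcons size_fps_inv_seq ltnn eqxx.
case: n => [|n] /=; first by rewrite big_ord0 addr0 divrr.
rewrite mulrN mulrA divrr // mul1r; apply/eqP; rewrite addrC subr_eq0.
apply/eqP/eq_bigr => i _; congr (_ * _); rewrite subSS.
by rewrite [in RHS](nth_fps_inv_seq f (n := n.+1)) // ltnS leq_subr.
Qed.

Fact fps_unitP f g : g * f = 1 -> fps_unit f.
Proof.
move=> /fpsP/(_ 0%N); rewrite fps_mulE big_ord1 subnn /= => gf1.
by apply/unitrP; exists (g 0%N); split; last rewrite mulrC.
Qed.

Fact fps_inv_out : {in [predC fps_unit], fps_inv =1 id}.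
Proof.
by move=> f /negP nUf; rewrite /fps_inv; case: ifP.
Qed.

HB.instance Definition _ := GRing.ComNzRing_hasMulInverse.Build (fps R)
  fps_mulVr fps_unitP fps_inv_out.

Lemma fps_unitE f : (f \is a GRing.unit) = (f 0%N \is a GRing.unit).
Proof. by []. Qed.

End FpsUnitRing.

(* Series in two variables are iterated: [f a b] is the coefficient of the
   monomial whose exponent is [a] in the first and [b] in the second variable. *)
Notation fps2 R := (fps (fps R)).

Definition Fps2 (R : Type) (m : nat -> nat -> R) : fps2 R :=
  Fps (fun a => Fps (m a)).
Definition fpsX1 (R : comUnitRingType) : fps2 R := fpsX (fps R).
Definition fpsX2 (R : comUnitRingType) : fps2 R := fpsC (fpsX R).

Section Multiplicity.
Variable F : fieldType.

Definition schur2 (l1 l2 : nat) : fps2 F :=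
  let x := fpsX1 F in let y := fpsX2 F in let p := (l1 - l2)%N in
  (x * y) ^+ l2 * \sum_(i < p.+1) x ^+ (p - i) * y ^+ i.

(* [schur2 l1 l2] is homogeneous of degree [l1 + l2], so no partition with
   [a + b < l1] contributes to the coefficient of x^a y^b. The values [m l1 l2]
   with [l1 < l2] are irrelevant. *)
Definition schur_expansion (f : fps2 F) (m : nat -> nat -> F) : Prop :=
  forall a b : nat,
    f a b = \sum_(l1 < (a + b).+1) \sum_(l2 < l1.+1)
              m l1 l2 * (schur2 l1 l2) a b.

(* The default value is only reached when [f] is not symmetric. *)
Definition schur_mult (f : fps2 F) : nat -> nat -> F :=
  if pselect (exists m, schur_expansion f m) is left ex then sval (cid ex)
  else fun _ _ => 0.

Definition mult_series (f : fps2 F) : fps2 F :=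
  Fps2 (fun p q => schur_mult f (p + q)%N q).

End Multiplicity.

(* [gen_alg iota S] is the unital F-subalgebra of [A] generated by [S], for the
   F-algebra structure on [A] given by the ring morphism [iota : F -> A]. *)
Inductive gen_alg (F A : pzRingType) (iota : F -> A) (S : A -> Prop) :
    A -> Prop :=
| gen_alg_gen a : S a -> gen_alg iota S a
| gen_alg_const c : gen_alg iota S (iota c)
| gen_alg_add a b :
    gen_alg iota S a -> gen_alg iota S b -> gen_alg iota S (a + b)
| gen_alg_mul a b :
    gen_alg iota S a -> gen_alg iota S b -> gen_alg iota S (a * b).

(* The variable at [gvar k i j] is the (i, j) entry of the k-th matrix. *)
Definition gvar (k : 'I_2) (i j : 'I_3) : 'I_(2 * (3 * 3)) :=
  mxvec_index k (mxvec_index i j).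

Section MixedTrace.
Variable F : fieldType.

Notation P := {mpoly F[2 * (3 * 3)]}.

Definition gen_mx (k : 'I_2) : 'M[P]_3 := \matrix_(i, j) 'X_(gvar k i j).

Definition word_mx (w : seq 'I_2) : 'M[P]_3 := \prod_(k <- w) gen_mx k.

Definition mx_const (c : F) : 'M[P]_3 := (c%:MP)%:M.

Definition generic_alg : 'M[P]_3 -> Prop :=
  gen_alg mx_const (fun A => exists k, A = gen_mx k).

Definition pure_trace : P -> Prop :=
  gen_alg (fun c : F => c%:MP)
    (fun p => exists2 w, w != [::] & p = \tr (word_mx w)).

Definition mixed_trace : 'M[P]_3 -> Prop :=
  gen_alg mx_const
    (fun A => generic_alg A \/ exists2 p, pure_trace p & A = p%:M).

Definition mnm_deg (k : 'I_2) (m : 'X_{1..2 * (3 * 3)}) : nat :=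
  (\sum_(i < 3) \sum_(j < 3) m (gvar k i j))%N.

Definition multihomog (k1 k2 : nat) (p : P) : Prop :=
  forall m, m \in msupp p ->
    mnm_deg ord0 m = k1 /\ mnm_deg ord_max m = k2.

Definition mixed_trace_comp (k1 k2 : nat) (A : 'M[P]_3) : Prop :=
  mixed_trace A /\ forall i j, multihomog k1 k2 (A i j).

Definition has_dim (V : 'M[P]_3 -> Prop) (n : nat) : Prop :=
  exists e : 'I_n -> 'M[P]_3,
    [/\ forall i, V (e i),
        forall c : 'I_n -> F,
          \sum_i (c i)%:MP *: e i = 0 -> forall i, c i = 0
      & forall A, V A -> exists c : 'I_n -> F, A = \sum_i (c i)%:MP *: e i].

(* The default value is only reached when [V] is infinite dimensional. *)
Definition dimF (V : 'M[P]_3 -> Prop) : nat :=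
  if pselect (exists n, has_dim V n) is left ex then sval (cid ex) else 0%N.

Definition hilbert_mixed_trace : fps2 F :=
  Fps2 (fun k1 k2 => (dimF (mixed_trace_comp k1 k2))%:R).

End MixedTrace.

(* Main.v *)
Require Import Defs.
From HB Require Import structures.
From mathcomp Require Import all_boot all_order all_algebra.
From mathcomp Require Import boolp.
From mathcomp Require Import ring zify.
From mathcomp.multinomials Require Import mpoly.

Set Implicit Arguments.
Unset Strict Implicit.
Unset Printing Implicit Defensive.

Import GRing.Theory.
Local Open Scope ring_scope.

(** The mixed trace algebra T is a free module over a polynomial ring in ten
    traces, with an explicit basis of eighteen words. The Hilbert series is read
    off from this basis, and the multiplicity series from the Hilbert series.

    The ten traces are tr(X), tr(X^2), tr(X^3), tr(Y), tr(XY), tr(X^2 Y), tr(Y^2),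
    tr(XY^2), tr(X^2 Y^2) and tr(Y^3), where X and Y are the generic matrices, and
    the words are X^i u with i < 3 and u among 1, Y, Y^2, YX, YXY, YXY^2. Let Q be
    the ring generated by the traces.

    Spanning. The Cayley-Hamilton equation and its polarization
    A^2 B + ABA + BA^2 = (lower terms) rewrite X^3, Y^3, YX^2, Y^2 X and YXYX into
    the Q-span of the words ([module_spanM]). The traces of the words lie in Q,
    except that of X^2 YXY^2. As a scalar matrix the latter still lies in the
    span, since up to a factor and an element of Q it is the determinant of the
    commutator [X, Y] ([module_span_trace]). Hence T is contained in the span
    ([mixed_trace_span]).

    Independence. The base point is X = diag(0, 1, -1) and Y the matrix of a
    cyclic permutation. The gradients of the ten traces are independent there, so
    the traces are algebraically independent by the Jacobian criterion
    ([tau_alg_independent]). The words take values in a space of dimension 9, so a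
    second family of equations is needed: the ten traces do not change when X and
    Y are transposed, hence a relation between the words also holds for the
    transposed matrices. At the base point the two families of nine equations have
    only the zero solution ([words_free]).

    Series. A multihomogeneous component of T has for basis the products of the
    same multidegree ([mixed_trace_comp_dim]), which gives
    H = (1 + x + x^2)(1 + y + y^2)(1 + xy) / (product of the ten 1 - x^a y^b),
    that is, [hilbert_mixed_trace_inv]. If M is the multiplicity series of a
    symmetric H then (x - y) H(x,y) = x M(x,xy) - y M(y,xy), and the two terms on
    the right have disjoint supports, so M is the only series with this property
    ([mult_series_unique]). It remains to check this identity for the rational
    function of the theorem, and to decompose it into partial fractions. *)

(** * Multiplicity series in two variables *)

Section Series.
Variable F : fieldType.
Implicit Types f g h : fps2 F.

Lemma fps2P f g : (forall a b, f a b = g a b) -> f = g.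
Proof. by move=> fg; apply/fpsP => a; apply/fpsP => b. Qed.

Lemma fps_sumE (R : zmodType) (I : Type) (r : seq I) (P : pred I)
    (G : I -> fps R) n : (\sum_(i <- r | P i) G i) n = \sum_(i <- r | P i) G i n.
Proof. by elim/big_rec2: _ => // i y1 y2 _ <-. Qed.

Lemma fps2_mulE f g a b :
  (f * g) a b = \sum_(i < a.+1) \sum_(j < b.+1) f i j * g (a - i)%N (b - j)%N.
Proof. by rewrite fps_mulE fps_sumE. Qed.

Lemma fps2_1E a b : (1 : fps2 F) a b = ((a == 0%N) && (b == 0%N))%:R.
Proof. by case: a => [|a] /=; case: b => [|b]. Qed.

(** The substitution t -> x, v -> xy. *)
Definition subst_diag f : fps2 F :=
  Fps2 (fun a b => if (b <= a)%N then f (a - b)%N b else 0).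

Definition fps_swap f : fps2 F := Fps2 (fun a b => f b a).

Lemma subst_diagE f a b :
  subst_diag f a b = if (b <= a)%N then f (a - b)%N b else 0.
Proof. by []. Qed.

Lemma fps_swapE f a b : fps_swap f a b = f b a.
Proof. by []. Qed.

Fact subst_diag_zmod : zmod_morphism subst_diag.
Proof.
move=> f g; apply: fps2P => a b /=; case: ifP => // _.
by rewrite subr0.
Qed.

Fact subst_diag_monoid : monoid_morphism subst_diag.
Proof.
split=> [|f g]; apply: fps2P => a b.
  rewrite subst_diagE !fps2_1E; case: leqP => [le_ba|lt_ab].
    by congr (nat_of_bool _)%:R; apply/idP/idP; lia.
  by rewrite (_ : _ && _ = false) //; lia.
rewrite subst_diagE [RHS]fps2_mulE [RHS]exchange_big /=; case: (leqP b a) => [le_ba|lt_ab]; last first.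
  rewrite big1 // => j _; rewrite big1 // => i _.
  case: leqP => [le_ji|]; last by rewrite mul0r.
  by rewrite ifN ?mulr0 // -ltnNge; have := ltn_ord i; have := ltn_ord j; lia.
rewrite fps2_mulE exchange_big /=; apply: eq_bigr => j _.
have le_jb : (j <= b)%N by rewrite -ltnS.
pose G i := (if (j <= i)%N then f (i - j)%N j else 0)
  * (if (b - j <= a - i)%N then g (a - i - (b - j))%N (b - j)%N else 0).
rewrite -(big_mkord xpredT G) (big_cat_nat (n := j)) /=; [|lia|lia].
rewrite (big_cat_nat (m := j) (n := (a - b).+1 + j)) /=; [|lia|lia].
rewrite [X in _ = X + _]big_nat_cond [X in _ = X + _]big1 ?add0r; last first.
  by move=> i lt_ij; rewrite /G ifN ?mul0r //; lia.
rewrite [X in _ = _ + X]big_nat_cond [X in _ = _ + X]big1 ?addr0; last first.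
  by move=> i le_i; rewrite /G [X in _ * X]ifN ?mulr0 //; lia.
rewrite -[RHS]/(\sum_(0 + j <= i < (a - b).+1 + j) G i) big_addn addnK big_mkord; apply: eq_bigr => i _.
have lt_i := ltn_ord i.
rewrite /G leq_addl addnK ifT; last by lia.
by congr (_ * fps_coef (fps_coef _ _) _); lia.
Qed.

HB.instance Definition _ :=
  GRing.isZmodMorphism.Build (fps2 F) (fps2 F) subst_diag subst_diag_zmod.
HB.instance Definition _ :=
  GRing.isMonoidMorphism.Build (fps2 F) (fps2 F) subst_diag subst_diag_monoid.

Fact fps_swap_zmod : zmod_morphism fps_swap.
Proof. by move=> f g; apply: fps2P. Qed.

Fact fps_swap_monoid : monoid_morphism fps_swap.
Proof.
split=> [|f g]; apply: fps2P => a b.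
  by rewrite fps_swapE !fps2_1E andbC.
by rewrite fps_swapE !fps2_mulE exchange_big.
Qed.

HB.instance Definition _ :=
  GRing.isZmodMorphism.Build (fps2 F) (fps2 F) fps_swap fps_swap_zmod.
HB.instance Definition _ :=
  GRing.isMonoidMorphism.Build (fps2 F) (fps2 F) fps_swap fps_swap_monoid.

Notation x := (fpsX1 F).
Notation y := (fpsX2 F).

Lemma fps2_X1E a b : x a b = ((a == 1%N) && (b == 0%N))%:R.
Proof. by rewrite /fpsX1 /=; case: (a == 1%N); case: b. Qed.
Lemma fps2_X2E a b : y a b = ((a == 0%N) && (b == 1%N))%:R.
Proof. by rewrite /fpsX2 /=; case: (a == 0%N). Qed.

Lemma fps2_mulX1 f a b : (x * f) a b = if a is a'.+1 then f a' b else 0.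
Proof.
rewrite fps2_mulE; case: a => [|a].
  by rewrite big_ord1 big1 // => j _; rewrite fps2_X1E mul0r.
rewrite big_ord_recl big1 ?add0r => [|j _]; last by rewrite fps2_X1E mul0r.
rewrite big_ord_recl [X in _ + X]big1 ?addr0 => [|i _]; last first.
  by rewrite big1 // => j _; rewrite fps2_X1E mul0r.
rewrite big_ord_recl [X in _ + X]big1 ?addr0 => [|i _]; last first.
  by rewrite fps2_X1E mul0r.
by rewrite fps2_X1E /= mul1r subn0 subSS subn0.
Qed.

Lemma fps_swapX1 : fps_swap x = y.
Proof. by apply: fps2P => a b; rewrite fps_swapE fps2_X1E fps2_X2E andbC. Qed.
Lemma fps_swapK : involutive fps_swap.
Proof. by move=> f; apply: fps2P. Qed.
Lemma fps_swapX2 : fps_swap y = x.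
Proof. by rewrite -fps_swapX1 fps_swapK. Qed.

Lemma fps2_mulX2 f a b : (y * f) a b = if b is b'.+1 then f a b' else 0.
Proof.
have <- : (x * fps_swap f) b a = (y * f) a b.
  by rewrite -fps_swapX1 -[f in RHS]fps_swapK -rmorphM.
by rewrite fps2_mulX1; case: b.
Qed.

Lemma fps2_mulX12 i j f a b : (x ^+ i * y ^+ j * f) a b
  = if (i <= a)%N && (j <= b)%N then f (a - i)%N (b - j)%N else 0.
Proof.
elim: i a => [|i IHi] a.
  rewrite expr0 mul1r leq0n subn0 andTb; elim: j b => [|j IHj] b.
    by rewrite expr0 mul1r subn0.
  by rewrite exprS -mulrA fps2_mulX2; case: b => [|b]; rewrite ?IHj ?subSS.
by rewrite exprS -!mulrA fps2_mulX1; case: a => [|a]; rewrite // mulrA IHi.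
Qed.

Lemma fps2_X12 i j a b : (x ^+ i * y ^+ j) a b = ((a == i) && (b == j))%:R.
Proof.
rewrite -[_ * _]mulr1 fps2_mulX12 fps2_1E; case: ifP => [|] ij.
  by congr (nat_of_bool _)%:R; apply/idP/idP; lia.
by rewrite (_ : _ && _ = false) //; lia.
Qed.

Lemma subst_diagX1 : subst_diag x = x.
Proof.
apply: fps2P => a b; rewrite subst_diagE !fps2_X1E.
by case: ifP => le_ba; [congr (nat_of_bool _)%:R; apply/idP/idP; lia | rewrite (_ : _ && _ = false) //; lia].
Qed.

Lemma subst_diagX2 : subst_diag y = x * y.
Proof.
apply: fps2P => a b.
rewrite subst_diagE -[x]expr1 -[y in RHS]expr1 fps2_X12 fps2_X2E.
by case: ifP => le_ba; [congr (nat_of_bool _)%:R; apply/idP/idP; lia | rewrite (_ : _ && _ = false) //; lia].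
Qed.

Lemma schur2E (l1 l2 a b : nat) : (l2 <= l1)%N ->
  schur2 F l1 l2 a b
  = [&& (a + b == l1 + l2)%N, (l2 <= a)%N & (l2 <= b)%N]%:R.
Proof.
move=> le_l; rewrite /schur2 exprMn fps2_mulX12; case: ifP => [/andP[la lb]|_].
  rewrite fps_sumE fps_sumE andbT.
  under eq_bigr do rewrite fps2_X12.
  case: eqP => [abE|abN].
    have lt_b : (b - l2 < (l1 - l2).+1)%N by lia.
    rewrite (bigD1 (Ordinal lt_b)) //= eqxx andbT.
    rewrite (_ : (a - l2 == _)%N = true) /=; last by lia.
    rewrite big1 ?addr0 // => i /eqP iN.
    rewrite (_ : _ && _ = false) //; apply/negP => /andP[_ /eqP iE].
    by apply: iN; apply: val_inj; rewrite /= iE.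
  rewrite big1 // => i _; rewrite (_ : _ && _ = false) //.
  by have := ltn_ord i; lia.
by rewrite andbF.
Qed.

(** S_(l1,l2) is the sum of the monomials of degree l1 + l2 in which both
    exponents are at least l2. *)
Lemma schur_expansionE f m : schur_expansion f m <->
  forall a b : nat, f a b = \sum_(j < (minn a b).+1) m (a + b - j)%N j.
Proof.
suff E a b : \sum_(l1 < (a + b).+1) \sum_(l2 < l1.+1) m l1 l2 * schur2 F l1 l2 a b
    = \sum_(j < (minn a b).+1) m (a + b - j)%N j.
  by split=> h a b; rewrite h E.
pose G (l1 l2 : nat) := if [&& (a + b == l1 + l2)%N, (l2 <= a)%N & (l2 <= b)%N]
  then m l1 l2 else 0.
transitivity (\sum_(l1 < (a + b).+1) \sum_(l2 < (a + b).+1 | (l2 <= l1)%N) G l1 l2).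
  apply: eq_bigr => l1 _; have le_l1 : (l1 <= a + b)%N by rewrite -ltnS.
  rewrite (big_ord_narrow_leq le_l1) /=.
  apply: eq_bigr => l2 _; rewrite schur2E -1?ltnS // /G.
  by case: ifP => _; rewrite ?mulr1 ?mulr0.
have le_m : ((minn a b).+1 <= (a + b).+1)%N by lia.
rewrite (big_ord_widen _ (fun j => m (a + b - j)%N j) le_m).
rewrite (exchange_big_dep predT) //= [RHS]big_mkcond /=.
apply: eq_bigr => l2 _; case: ifP => [lt_l2|nlt_l2]; last first.
  by rewrite big1 // => l1 _; rewrite /G ifN //; lia.
have lt_l1 : (a + b - l2 < (a + b).+1)%N by lia.
rewrite (bigD1 (Ordinal lt_l1)) /=; last by lia.
rewrite /G /= ifT; last by lia.
rewrite big1 ?addr0 // => l1 /andP[_ /eqP l1N]; rewrite ifN //.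
by apply/negP => /and3P[/eqP abE _ _]; apply: l1N; apply: val_inj => /=; lia.
Qed.

(** The sums of [schur_expansionE] at (a, b) and (a + 1, b - 1), b <= a, differ in
    the single term m(a, b). Conversely these differences telescope to f(a, b),
    and symmetry gives the coefficients with a < b. *)
Lemma mult_seriesE f : fps_swap f = f -> forall p q : nat, mult_series f p q
  = f (p + q)%N q - (if q is q'.+1 then f (p + q).+1 q' else 0).
Proof.
move=> symf p q; rewrite /mult_series /= /schur_mult; case: pselect => [ex|nex].
  case: (cid ex) => m /= /schur_expansionE mE; rewrite !mE.
  rewrite (minn_idPr _) ?leq_addl //.
  case: q => [|q]; first by rewrite big_ord1 subr0 subn0 !addn0.
  rewrite mE big_ord_recr /= (minn_idPr _); last by lia.
  rewrite addrAC addnK -sumrB big1 ?add0r // => i _.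
  by apply/eqP; rewrite subr_eq0; apply/eqP; congr (m _ _); lia.
case: nex; exists (fun l1 l2 => f l1 l2 - (if l2 is l'.+1 then f l1.+1 l' else 0)).
apply/schur_expansionE => a b.
wlog le_ba: a b / (b <= a)%N => [W|].
  case/orP: (leq_total b a) => /W // E.
  by rewrite (addnC a) (minnC a) -E -{1}symf.
pose G l1 l2 := f l1 l2 - (if l2 is l'.+1 then f l1.+1 l' else 0).
suff T c : (c <= a + b)%N -> \sum_(j < c.+1) G (a + b - j)%N j = f (a + b - c)%N c.
  by rewrite (minn_idPr _) // T ?leq_addl // addnK.
elim: c => [|c IHc] lt_c; first by rewrite big_ord1 /G subr0.
rewrite big_ord_recr /= IHc 1?ltnW // /G.
have -> : (a + b - c.+1).+1 = (a + b - c)%N by rewrite -subSn.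
by rewrite addrCA subrr addr0.
Qed.

(** If f = sum of m(p+q, q) S_(p+q,q) and g = sum of m(p+q, q) t^p v^q, then the
    determinantal formula for Schur functions says that (x - y) f is the
    antisymmetrization of x g(x, xy). The two halves of it have disjoint
    supports, so that g can be read off. *)
Lemma mult_series_unique f g : fps_swap f = f ->
  (x - y) * f = x * subst_diag g - fps_swap (x * subst_diag g) ->
  mult_series f = g.
Proof.
move=> symf eq_fg; apply: fps2P => p q; rewrite mult_seriesE //.
have := congr1 (fun h : fps2 F => h (p + q).+1 q) eq_fg.
have subE h1 h2 a b : (h1 - h2 : fps2 F) a b = h1 a b - h2 a b by [].
rewrite mulrBl !subE fps_swapE !fps2_mulX1 fps2_mulX2.
rewrite subst_diagE leq_addl addnK => ->.
case: q => [|q]; first by rewrite subr0.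
by rewrite subst_diagE ifN ?subr0 //; lia.
Qed.

End Series.

(** * The rational functions *)

Section Rational.
Variable R : comUnitRingType.
Implicit Types s t v x y : R.

Definition mult_num t v : R :=
  v ^+ 2 * (v ^+ 4 - v ^+ 3 + 3 * v ^+ 2 - v + 1) * t ^+ 3
  + v * (2 * v ^+ 4 - 4 * v ^+ 3 + v ^+ 2 - v - 1) * t ^+ 2
  + v * (- v ^+ 4 - v ^+ 3 + v ^+ 2 - 4 * v + 2) * t
  + (v ^+ 4 - v ^+ 3 + 3 * v ^+ 2 - v + 1).

Definition mult_den t v : R :=
  (1 - v) ^+ 7 * (1 + v) ^+ 4 * (1 + v ^+ 2)
  * (1 - t) ^+ 3 * (1 + t) * (1 - v * t).

Definition hilbert_den x y : R :=
  (1 - x) ^+ 2 * (1 - y) ^+ 2 * (1 - x ^+ 2) * (1 - y ^+ 2)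
  * (1 - x * y) ^+ 2 * (1 - x ^+ 2 * y) * (1 - x * y ^+ 2).

(** What remains of [antisym_hilbert] once the factors common to the denominators
    are cancelled. *)
Lemma antisym_num x y :
  x * mult_num x (x * y) * ((1 - y) ^+ 3 * (1 + y) * (1 - x * y ^+ 2))
  - y * mult_num y (x * y) * ((1 - x) ^+ 3 * (1 + x) * (1 - x ^+ 2 * y))
  = (x - y) * ((1 - x * y) ^+ 5 * (1 + x * y) ^+ 4 * (1 + (x * y) ^+ 2)).
Proof. rewrite /mult_num; ring. Qed.

(** With M = num/den and H = 1/hilbert_den this says
    (x - y) H(x,y) = x M(x,xy) - y M(y,xy). *)
Lemma antisym_hilbert x y :
  (x * mult_num x (x * y) * mult_den y (x * y)
   - y * mult_num y (x * y) * mult_den x (x * y)) * hilbert_den x y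
  = (x - y) * (mult_den x (x * y) * mult_den y (x * y)).
Proof.
(* V is the part of the denominators in v = xy alone. *)
pose V := (1 - x * y) ^+ 7 * (1 + x * y) ^+ 4 * (1 + (x * y) ^+ 2).
pose A := (1 - x) ^+ 3 * (1 + x) * (1 - x ^+ 2 * y).
pose B := (1 - y) ^+ 3 * (1 + y) * (1 - x * y ^+ 2).
have -> : mult_den x (x * y) = V * A by rewrite /mult_den /V /A; ring.
have -> : mult_den y (x * y) = V * B by rewrite /mult_den /V /B; ring.
have -> : hilbert_den x y = A * B * (1 - x * y) ^+ 2.
  by rewrite /hilbert_den /A /B; ring.
have -> : x * mult_num x (x * y) * (V * B) - y * mult_num y (x * y) * (V * A)
    = V * (x * mult_num x (x * y) * B - y * mult_num y (x * y) * A).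
  by rewrite mulrBr; congr (_ - _); rewrite mulrCA.
rewrite antisym_num /V; move: A B => A B; ring.
Qed.

Lemma hilbert_denC x y : hilbert_den y x = hilbert_den x y.
Proof. by rewrite /hilbert_den; ring. Qed.

Lemma mul_frac (n d e u : R) : d \is a GRing.unit -> u = d * e ->
  u * (n / d) = n * e.
Proof. by move=> Ud ->; rewrite mulrC [d * e]mulrC mulrA mulrAC mulrVK // mulrC. Qed.

Lemma antisym_frac (x y f D nx ny dx dy : R) :
  dx \is a GRing.unit -> dy \is a GRing.unit ->
  (x * nx * dy - y * ny * dx) * D = (x - y) * (dx * dy) -> f * D = 1 ->
  (x - y) * f = x * (nx / dx) - y * (ny / dy).
Proof.
move=> Ux Uy eqD fD; apply: (mulIr Uy); apply: (mulIr Ux).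
rewrite -[RHS]mulr1 -fD.
have -> : (x - y) * f * dy * dx = f * ((x - y) * (dx * dy)) by ring.
rewrite -eqD; set a := nx / dx; set b := ny / dy.
have -> : nx = a * dx by rewrite divrK.
have -> : ny = b * dy by rewrite divrK.
by clearbody a b; ring.
Qed.

Arguments mul_frac : clear implicits.

Lemma partial_fractions t v :
  let s := 1 - v in let p := 1 + v in let q := 1 + v ^+ 2 in
  [/\ (2 : R) \is a GRing.unit, s \is a GRing.unit, p \is a GRing.unit
    & q \is a GRing.unit] ->
  [/\ 1 - t \is a GRing.unit, 1 + t \is a GRing.unit
    & 1 - v * t \is a GRing.unit] ->
  mult_num t v / mult_den t v
  = 1 / (2 * s ^+ 6 * p ^+ 2) / (1 - t) ^+ 3
  + (3 * v ^+ 2 - 2 * v + 1) / (2 ^+ 2 * s ^+ 7 * p ^+ 3) / (1 - t) ^+ 2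
  + (v ^+ 4 - 6 * v ^+ 3 + 14 * v ^+ 2 - 6 * v + 1) / (2 ^+ 3 * s ^+ 8 * p ^+ 4)
    / (1 - t)
  + 1 / (2 ^+ 3 * s ^+ 2 * p ^+ 4 * q) / (1 + t)
  + - v ^+ 4 / (s ^+ 8 * p ^+ 4 * q) / (1 - v * t).
Proof.
move=> s p q [U2 Us Up Uq] [U1 U3 Uv].
have div2 n a b : a \is a GRing.unit -> b \is a GRing.unit -> n / a / b = n / (a * b) :> R.
  by move=> Ua Ub; rewrite invrM // [b^-1 * _]mulrC mulrA.
rewrite !div2 ?unitrM ?unitrX ?U2 ?Us ?Up ?Uq ?U1 ?U3 ?Uv //.
(* U is a common denominator of the six fractions. *)
pose U := 2 ^+ 3 * s ^+ 8 * p ^+ 4 * q * (1 - t) ^+ 3 * (1 + t) * (1 - v * t).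
have UU : U \is a GRing.unit.
  by rewrite /U ?unitrM ?unitrX ?U2 ?Us ?Up ?Uq ?U1 ?U3 ?Uv.
apply: (mulrI UU); rewrite 4![U * (_ + _)]mulrDr.
rewrite (mul_frac _ _ (2 ^+ 3 * s) U); first last.
- by rewrite /U /mult_den -/s -/p -/q; ring.
- by rewrite /mult_den -/s -/p -/q ?unitrM ?unitrX ?Us ?Up ?Uq ?U1 ?U3 ?Uv.
rewrite (mul_frac _ _ (2 ^+ 2 * s ^+ 2 * p ^+ 2 * q * (1 + t) * (1 - v * t)) U);
  first last.
- by rewrite /U; ring.
- by rewrite ?unitrM ?unitrX ?U2 ?Us ?Up ?Uq ?U1 ?U3 ?Uv.
rewrite (mul_frac _ _ (2 * s * p * q * (1 - t) * (1 + t) * (1 - v * t)) U);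
  first last.
- by rewrite /U; ring.
- by rewrite ?unitrM ?unitrX ?U2 ?Us ?Up ?Uq ?U1 ?U3 ?Uv.
rewrite (mul_frac _ _ (q * (1 - t) ^+ 2 * (1 + t) * (1 - v * t)) U); first last.
- by rewrite /U; ring.
- by rewrite ?unitrM ?unitrX ?U2 ?Us ?Up ?Uq ?U1 ?U3 ?Uv.
rewrite (mul_frac _ _ (s ^+ 6 * (1 - t) ^+ 3 * (1 - v * t)) U); first last.
- by rewrite /U; ring.
- by rewrite ?unitrM ?unitrX ?U2 ?Us ?Up ?Uq ?U1 ?U3 ?Uv.
rewrite (mul_frac _ _ (2 ^+ 3 * (1 - t) ^+ 3 * (1 + t)) U); first last.
- by rewrite /U; ring.
- by rewrite ?unitrM ?unitrX ?U2 ?Us ?Up ?Uq ?U1 ?U3 ?Uv.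
rewrite /mult_num /s /p /q; ring.
Qed.

End Rational.

(** The morphism is unbundled, so that these statements apply to a substitution
    through its two defining facts. *)
Section Morph.
Variables (R S : comUnitRingType) (h : R -> S).
Hypotheses (hz : zmod_morphism h) (hm : monoid_morphism h).

Let h' : {rmorphism R -> S} := HB.pack h
  (GRing.isZmodMorphism.Build R S h hz) (GRing.isMonoidMorphism.Build R S h hm).

Let hE := (rmorphD h', rmorphN h', rmorphM h', rmorphXn h', rmorph1 h', rmorph_nat h').

Lemma morph_mult_num t v : h (mult_num t v) = mult_num (h t) (h v).
Proof. by rewrite -[h]/(h' : _ -> _) /mult_num !hE. Qed.

Lemma morph_mult_den t v : h (mult_den t v) = mult_den (h t) (h v).
Proof. by rewrite -[h]/(h' : _ -> _) /mult_den !hE. Qed.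

Lemma morph_hilbert_den t v : h (hilbert_den t v) = hilbert_den (h t) (h v).
Proof. by rewrite -[h]/(h' : _ -> _) /hilbert_den !hE. Qed.

End Morph.

Section MultSeries.
Variable F : fieldType.

Notation x := (fpsX1 F).
Notation y := (fpsX2 F).

Lemma fps2_unitE (f : fps2 F) : (f \is a GRing.unit) = (f 0%N 0%N != 0).
Proof. by rewrite fps_unitE fps_unitE unitfE. Qed.

Lemma fps2_coef0D (f g : fps2 F) : (f + g) 0%N 0%N = f 0%N 0%N + g 0%N 0%N.
Proof. by []. Qed.
Lemma fps2_coef0N (f : fps2 F) : (- f) 0%N 0%N = - f 0%N 0%N.
Proof. by []. Qed.
Lemma fps2_coef01 : (1 : fps2 F) 0%N 0%N = 1.
Proof. by []. Qed.
Lemma fps2_coef0M (f g : fps2 F) : (f * g) 0%N 0%N = f 0%N 0%N * g 0%N 0%N.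
Proof. by rewrite fps2_mulE !big_ord1. Qed.

Lemma fps2_coef0X (f : fps2 F) n : (f ^+ n) 0%N 0%N = f 0%N 0%N ^+ n.
Proof. by elim: n => [|n IH]; rewrite ?expr0 // !exprS fps2_coef0M IH. Qed.

Definition fps2_coef0E := (fps2_coef0D, fps2_coef0N, fps2_coef01, fps2_coef0M, fps2_coef0X).

Lemma fps_swap_hilbert_den u w :
  fps_swap (hilbert_den u w : fps2 F) = hilbert_den (fps_swap u) (fps_swap w).
Proof. exact: morph_hilbert_den (@fps_swap_zmod F) (@fps_swap_monoid F) u w. Qed.
Lemma fps_swap_mult_num u w :
  fps_swap (mult_num u w : fps2 F) = mult_num (fps_swap u) (fps_swap w).
Proof. exact: morph_mult_num (@fps_swap_zmod F) (@fps_swap_monoid F) u w. Qed.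
Lemma fps_swap_mult_den u w :
  fps_swap (mult_den u w : fps2 F) = mult_den (fps_swap u) (fps_swap w).
Proof. exact: morph_mult_den (@fps_swap_zmod F) (@fps_swap_monoid F) u w. Qed.
Lemma subst_diag_mult_num u w :
  subst_diag (mult_num u w : fps2 F) = mult_num (subst_diag u) (subst_diag w).
Proof. exact: morph_mult_num (@subst_diag_zmod F) (@subst_diag_monoid F) u w. Qed.
Lemma subst_diag_mult_den u w :
  subst_diag (mult_den u w : fps2 F) = mult_den (subst_diag u) (subst_diag w).
Proof. exact: morph_mult_den (@subst_diag_zmod F) (@subst_diag_monoid F) u w. Qed.

(** By [mult_series_unique] only (x - y) H = x M(x,xy) - y M(y,xy) is needed. *)
Lemma mult_series_rational (f : fps2 F) : f * hilbert_den x y = 1 ->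
  mult_series f = mult_num x y / mult_den x y.
Proof.
move=> fD.
have UD : hilbert_den x y \is a GRing.unit by apply/unitrPr; exists f; rewrite mulrC.
have UM (t v : fps2 F) : t 0%N 0%N = 0 -> v 0%N 0%N = 0 -> mult_den t v \is a GRing.unit.
  move=> t0 v0; rewrite fps2_unitE /mult_den !fps2_coef0E t0 v0 mulr0 subr0 addr0.
  by rewrite !mulr1 oner_neq0.
apply: mult_series_unique.
  have swapD : fps_swap (hilbert_den x y) = hilbert_den x y.
    by rewrite fps_swap_hilbert_den fps_swapX1 fps_swapX2 hilbert_denC.
  by apply: (mulIr UD); rewrite -{1}swapD -rmorphM fD rmorph1.
have Uxy : mult_den x (x * y) \is a GRing.unit.
  by apply: UM; rewrite ?fps2_mulX1.
have Uyx : mult_den y (x * y) \is a GRing.unit.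
  by apply: UM; rewrite ?fps2_mulX1.
have swapM (g h : fps2 F) : fps_swap (g * h) = fps_swap g * fps_swap h.
  exact: rmorphM.
have diagV (g : fps2 F) : g \is a GRing.unit -> subst_diag g^-1 = (subst_diag g)^-1.
  exact: rmorphV.
have swapV (g : fps2 F) : g \is a GRing.unit -> fps_swap g^-1 = (fps_swap g)^-1.
  exact: rmorphV.
have -> : subst_diag (mult_num x y / mult_den x y)
    = mult_num x (x * y) / mult_den x (x * y).
  have UD' : mult_den x y \is a GRing.unit by apply: UM.
  have -> : subst_diag (mult_num x y / mult_den x y)
    = subst_diag (mult_num x y) * subst_diag (mult_den x y)^-1 by exact: rmorphM.
  rewrite (diagV _ UD') subst_diag_mult_num subst_diag_mult_den.
  by rewrite subst_diagX1 subst_diagX2.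
rewrite !swapM swapV // fps_swap_mult_num fps_swap_mult_den swapM.
rewrite fps_swapX1 fps_swapX2 [y * x]mulrC.
exact: antisym_frac (antisym_hilbert x y) fD.
Qed.

End MultSeries.

(** * Cayley-Hamilton and the span of the words *)

Lemma sum3 (V : nmodType) (G : 'I_3 -> V) :
  \sum_i G i = G 0 + G 1 + G (Ordinal (isT : 2 < 3)%N).
Proof.
rewrite !big_ord_recl big_ord0 addr0 addrA.
by congr (_ + G _ + G _); apply: val_inj.
Qed.

(** The part of degree 2 in A and 1 in B of the Cayley-Hamilton equation of
    A + B, whose coefficients are traces by Newton's identities. The factor 2
    clears the denominators of these identities. *)
Lemma cayley_hamilton_polar (R : comNzRingType) (A B : 'M[R]_3) :
  2 *: (A * A * B + A * B * A + B * A * A)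
  = (2 * \tr A) *: (A * B + B * A) + (2 * \tr B) *: (A * A)
    - (2 * (\tr A * \tr B - \tr (A * B))) *: A
    - (\tr A ^+ 2 - \tr (A * A)) *: B
    + (\tr A ^+ 2 * \tr B - \tr B * \tr (A * A) - 2 * \tr A * \tr (A * B)
       + 2 * \tr (A * A * B)) *: 1.
Proof.
apply/matrixP => i j; rewrite /mxtrace -!mulmxE ?(mxE, sum3).
do 6![rewrite ?(mxE, sum3)].
have E (k : 'I_3) : [|| k == 0, k == 1 | k == Ordinal (isT : 2 < 3)%N].
  by case: k => [[|[|[|]]]].
case/or3P: (E i) => /eqP ->; case/or3P: (E j) => /eqP -> /=.
all: rewrite ?eqxx /=. 
all: ring.
Qed.
Section Span.
Variables (R : comUnitRingType) (X Y : 'M[R]_3) (Q : R -> Prop).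
Hypotheses (Q1 : Q 1) (QB : forall a b, Q a -> Q b -> Q (a - b)).
Hypotheses (QM : forall a b, Q a -> Q b -> Q (a * b)).
Hypotheses (U2 : (2 : R) \is a GRing.unit) (Q2V : Q 2^-1).
Hypotheses (U3 : (3 : R) \is a GRing.unit) (Q3V : Q 3^-1).

Let Q0 : Q 0. Proof. by rewrite -[0](subrr 1); apply: QB. Qed.
Let QN a : Q a -> Q (- a). Proof. by rewrite -sub0r; apply: QB. Qed.
Let QD a b : Q a -> Q b -> Q (a + b).
Proof. by move=> Qa Qb; rewrite -[b]opprK; apply/QB/QN. Qed.
Let Q2 : Q 2. Proof. exact: QD. Qed.
Let QX a n : Q a -> Q (a ^+ n).
Proof. by move=> Qa; elim: n => // n IH; rewrite exprS; apply: QM. Qed.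
Let Q2I a : Q (2 * a) -> Q a.
Proof. by move=> /(QM Q2V); rewrite mulKr. Qed.

(** The products X^i * word_tail j, i < 3, are the words in X and Y that contain
    none of X^3, Y^3, Y X^2, Y^2 X and Y X Y X. *)
Definition word_tail (j : nat) : 'M[R]_3 :=
  [:: 1; Y; Y * Y; Y * X; Y * X * Y; Y * X * Y * Y]`_j.

Definition module_span (A : 'M[R]_3) : Prop :=
  exists2 c : 'I_3 -> 'I_6 -> R, forall i j, Q (c i j)
    & A = \sum_i \sum_j c i j *: (X ^+ i * word_tail j).
Notation S := module_span.

Lemma module_span0 : S 0.
Proof.
exists (fun _ _ => 0) => //; rewrite big1 // => i _.
by rewrite big1 // => j _; rewrite scale0r.
Qed.

Lemma module_spanD A B : S A -> S B -> S (A + B).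
Proof.
move=> [c Qc ->] [d Qd ->]; exists (fun i j => c i j + d i j).
  by move=> i j; apply: QD.
rewrite -big_split; apply: eq_bigr => i _; rewrite -big_split.
by apply: eq_bigr => j _; rewrite scalerDl.
Qed.

Lemma module_spanZ q A : Q q -> S A -> S (q *: A).
Proof.
move=> Qq [c Qc ->]; exists (fun i j => q * c i j) => [i j|]; first exact: QM.
rewrite scaler_sumr; apply: eq_bigr => i _; rewrite scaler_sumr.
by apply: eq_bigr => j _; rewrite scalerA.
Qed.

Lemma module_span_sum (I : finType) (G : I -> 'M[R]_3) :
  (forall i, S (G i)) -> S (\sum_i G i).
Proof.
by move=> SG; elim/big_ind: _ => // [|A B]; [apply: module_span0|apply: module_spanD].
Qed.

Let SN A : S A -> S (- A).
Proof. by rewrite -scaleN1r; apply/module_spanZ/QN. Qed.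
Let SB A B : S A -> S B -> S (A - B).
Proof. by move=> SA SB; apply/module_spanD/SN. Qed.
Let SI A B : S (A + B) -> S A -> S B.
Proof. by move=> SAB /(SB SAB); rewrite addrC addKr. Qed.
Let S2I A : S (2 *: A) -> S A.
Proof. by move=> /(module_spanZ Q2V); rewrite scalerA mulVr // scale1r. Qed.

Lemma module_span_gen i j : (i < 3)%N -> (j < 6)%N -> S (X ^+ i * word_tail j).
Proof.
move=> lti ltj.
exists (fun a b => ((a == i :> nat) && (b == j :> nat))%:R) => [a b|].
  by case: (_ && _).
rewrite (bigD1 (Ordinal lti)) //= [X in _ + X]big1 ?addr0 => [|a /eqP aN].
  rewrite (bigD1 (Ordinal ltj)) //= big1 ?addr0 ?eqxx ?scale1r // => b /eqP bN.
  rewrite (_ : (b == j :> nat) = false) ?scale0r //.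
  by apply/eqP => bj; apply: bN; apply: val_inj.
rewrite big1 // => b _; rewrite (_ : (a == i :> nat) = false) ?scale0r //.
by apply/eqP => ai; apply: aN; apply: val_inj.
Qed.

Let ST j : (j < 6)%N -> S (word_tail j).
Proof. by move=> ltj; rewrite -[word_tail j]mul1r -(expr0 X); apply: module_span_gen. Qed.

Let S1 : S 1 := @ST 0%N isT.
Let SY : S Y := @ST 1%N isT.
Let SYY : S (Y * Y) := @ST 2%N isT.
Let SYX : S (Y * X) := @ST 3%N isT.
Let SYXY : S (Y * (X * Y)). Proof. by rewrite mulrA; apply: (@ST 4%N). Qed.
Let SYXYY : S (Y * (X * (Y * Y))). Proof. by rewrite !mulrA; apply: (@ST 5%N). Qed.

Hypotheses (QX1 : Q (\tr X)) (QX2 : Q (\tr (X * X))) (QX3 : Q (\tr (X * X * X))).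
Hypotheses (QY1 : Q (\tr Y)) (QY2 : Q (\tr (Y * Y))) (QY3 : Q (\tr (Y * Y * Y))).
Hypotheses (QXY : Q (\tr (X * Y))) (QXXY : Q (\tr (X * X * Y))).
Hypotheses (QXYY : Q (\tr (X * Y * Y))) (QXXYY : Q (\tr (X * X * Y * Y))).

Let trC (A B : 'M[R]_3) : \tr (A * B) = \tr (B * A).
Proof. by rewrite -!mulmxE mxtrace_mulC. Qed.

Let Q3 : Q 3. Proof. by rewrite -[3]/(1 + 2) ?natrD; apply: QD. Qed.

Let S_polar (A B C D : 'M[R]_3) :
  Q (\tr A) -> Q (\tr B) -> Q (\tr (A * A)) -> Q (\tr (A * B)) ->
  Q (\tr (A * A * B)) -> S (C * D) -> S (C * A * D) -> S (C * B * D) ->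
  S (C * A * A * D) -> S (C * A * B * D) -> S (C * B * A * D) ->
  S (C * (A * A * B + A * B * A + B * A * A) * D).
Proof.
move=> QA QB' QAA QAB QAAB SC SA SB' SAA SAB SBA; apply: S2I.
rewrite scalerAl scalerAr cayley_hamilton_polar.
rewrite !mulrDr !mulrN -!scalerAr mulr1 [C * (_ + _)]mulrDr.
rewrite !mulrDl !mulNr -!scalerAl [(_ + _) * D]mulrDl !mulrA.
by do ?[apply: module_spanD | apply: SN | apply: module_spanZ | apply: QB
       | apply: QD | apply: QM | apply: QX].
Qed.

(** The trace of C times the polarized equation: it relates traces of words of
    the same degree modulo products of traces of shorter words. *)
Let Q_polar (A B C : 'M[R]_3) : Q (\tr A) -> Q (\tr B) -> Q (\tr (A * A)) -> Q (\tr (A * B)) ->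
  Q (\tr (A * A * B)) -> Q (\tr C) -> Q (\tr (A * C)) -> Q (\tr (B * C)) ->
  Q (\tr (A * A * C)) -> Q (\tr (A * B * C)) -> Q (\tr (B * A * C)) ->
  Q (\tr (A * A * B * C) + \tr (A * B * A * C) + \tr (B * A * A * C)).
Proof.
move=> QA QB' QAA QAB QAAB QC QAC QBC QAAC QABC QBAC; apply: Q2I.
have LD M N : \tr ((M + N) * C) = \tr (M * C) + \tr (N * C).
  by rewrite mulrDl mxtraceD.
have LN M : \tr (- M * C) = - \tr (M * C) by rewrite mulNr raddfN.
have LZ (a : R) M : \tr (a *: M * C) = a * \tr (M * C).
  by rewrite -scalerAl mxtraceZ.
have := congr1 (fun M => \tr (M * C)) (cayley_hamilton_polar A B).
rewrite !(LD, LN, LZ) mul1r => ->.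
by do ?[apply: QB | apply: QD | apply: QN | apply: QM | apply: QX].
Qed.


Let SX1 : S X. Proof. by rewrite -[X]mulr1; apply: (@module_span_gen 1 0). Qed.
Let SX2 : S (X * X).
Proof. by rewrite -[X * X]mulr1; apply: (@module_span_gen 2 0). Qed.

Let polar_diag (A : 'M[R]_3) : A * A * A + A * A * A + A * A * A = 3 *: (A * A * A).
Proof. by rewrite scaler_nat mulrSr mulr2n. Qed.

Let cube (A : 'M[R]_3) : Q (\tr A) -> Q (\tr (A * A)) -> Q (\tr (A * A * A)) ->
  exists a b c, [/\ Q a, Q b, Q c & A * A * A = a *: (A * A) + b *: A + c *: 1].
Proof.
move=> QA1 QA2 QA3; have := cayley_hamilton_polar A A.
rewrite polar_diag scalerA => /(congr1 (fun M => (2 * 3)^-1 *: M)).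
have U6 : (2 * 3 : R) \is a GRing.unit by rewrite unitrM U2.
have Q6 : Q (2 * 3)^-1 by rewrite invrM // ; apply: QM.
rewrite scalerA mulVr // scale1r => ->.
set t1 := \tr A; set t2 := \tr (A * A); set t3 := \tr (A * A * A).
exists ((2 * 3)^-1 * (2 * t1 * 2 + 2 * t1)).
exists ((2 * 3)^-1 * (- (2 * (t1 * t1 - t2)) - (t1 ^+ 2 - t2))).
exists ((2 * 3)^-1 * (t1 ^+ 2 * t1 - t1 * t2 - 2 * t1 * t2 + 2 * t3)).
split; try by do ?[apply: QB | apply: QD | apply: QN | apply: QM | apply: QX].
rewrite -!(scalerA (2 * 3)^-1) -!(scalerDr (2 * 3)^-1); congr (_ *: _).
rewrite -[A * A + A * A]mulr2n -scaler_nat scalerA.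
by rewrite [in RHS]scalerDl [(- _ - _) *: A]scalerDl !scaleNr !addrA.
Qed.

Let SXl A : S A -> S (X * A).
Proof.
move=> [c Qc ->]; rewrite mulr_sumr; apply: module_span_sum => i.
rewrite mulr_sumr; apply: module_span_sum => j; rewrite -scalerAr.
apply: module_spanZ => //; rewrite mulrA -exprS.
case: i => [[|[|[|//]]] /= _]; try exact: module_span_gen.
have [a [b [d [Qa Qb Qd X3E]]]] := cube QX1 QX2 QX3.
rewrite exprS expr2 mulrA X3E !mulrDl -!scalerAl mul1r -expr2 -[X in b *: (X * _)]expr1.
by do ?apply: module_spanD; apply: module_spanZ => //;
  [apply: module_span_gen | apply: module_span_gen | apply: ST].
Qed.

(** Since the span is stable under X on the left, right multiplication need only
    be checked on the tails. *)
Let Smulr M : (forall j, (j < 6)%N -> S (word_tail j * M)) ->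
  forall A, S A -> S (A * M).
Proof.
move=> SM A [c Qc ->]; rewrite mulr_suml; apply: module_span_sum => i.
rewrite mulr_suml; apply: module_span_sum => j; rewrite -scalerAl.
apply: module_spanZ => //; rewrite -mulrA.
by elim: (i : nat) => [|n IH]; rewrite ?mul1r ?exprS -?mulrA; [apply: SM | apply: SXl].
Qed.

Let SYr A : S A -> S (A * Y).
Proof.
have [a [b [d [Qa Qb Qd Y3E]]]] := cube QY1 QY2 QY3.
apply: Smulr => j; case: j => [|[|[|[|[|[|//]]]]]] _ //; rewrite /word_tail /=.
- by rewrite mul1r.
- by rewrite Y3E; do ?apply: module_spanD; apply: module_spanZ.
- exact: (@ST 4%N).
- exact: (@ST 5%N).
- rewrite -!mulrA [Y * (Y * Y)]mulrA Y3E !mulrDr -!scalerAr mulr1.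
  by do ?apply: module_spanD; apply: module_spanZ.
Qed.


(** The polarized equation at (X, Y) and at (Y, X) puts s1 and s2 in the span. They
    serve to rewrite Y X^2 and Y^2 X. *)
Let s1 := X * X * Y + X * Y * X + Y * X * X.
Let s2 := Y * Y * X + Y * X * Y + X * Y * Y.

Let QYX : Q (\tr (Y * X)). Proof. by rewrite trC. Qed.
Let QYYX : Q (\tr (Y * Y * X)). Proof. by rewrite trC mulrA. Qed.
Let SXY : S (X * Y). Proof. exact: SXl. Qed.

Let Ss1 : S s1.
Proof. by rewrite -[s1]mulr1 -[s1]mul1r; apply: S_polar; rewrite ?mulr1 ?mul1r. Qed.

Let SYXX : S (Y * X * X).
Proof.
by apply: (SI Ss1); apply: module_spanD; rewrite -!mulrA; do ?apply: SXl.
Qed.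

Let Ss2 : S s2.
Proof. by rewrite -[s2]mulr1 -[s2]mul1r; apply: S_polar; rewrite ?mulr1 ?mul1r. Qed.

Let SYYX : S (Y * Y * X).
Proof.
move: Ss2; rewrite /s2 -addrA addrC => /SI; apply; apply: module_spanD => //.
  by rewrite -mulrA.
by rewrite -!mulrA; do ?apply: SXl.
Qed.

(** X Y^2 X appears in the polarization at (X, Y^2) and in s2 X, and cancels. *)
Let SYXYX : S (Y * X * Y * X).
Proof.
have h1 : S (X * X * (Y * Y) + X * (Y * Y) * X + (Y * Y) * X * X).
  rewrite -[X in S X]mulr1 -[X in S (X * _)]mul1r.
  apply: S_polar; rewrite ?mulr1 ?mul1r ?mulrA //.
  by rewrite -!mulrA; do ?apply: SXl.
have h2 : S (s2 * X).
  rewrite -[s2]mul1r; apply: S_polar; rewrite ?mul1r //.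
  by rewrite -?mulrA; do ?apply: SXl; rewrite ?mulrA.
have -> : Y * X * Y * X = s2 * X - (X * X * (Y * Y) + X * (Y * Y) * X
    + (Y * Y) * X * X) + X * X * (Y * Y).
  have cancel (a b c d : 'M[R]_3) : a + b + c - (d + c + a) + d = b.
    have -> : a + b + c = b + (c + a) by rewrite addrC addrA addrC.
    by rewrite -[d + c + a]addrA [- _]opprD [_ + (- d - _)]addrCA addrK addrAC addNr add0r.
  by rewrite /s2 !mulrDl !mulrA cancel.
apply: module_spanD; first exact: SB.
by rewrite -!mulrA; do ?apply: SXl.
Qed.

Let SXr A : S A -> S (A * X).
Proof.
apply: Smulr => j; case: j => [|[|[|[|[|[|//]]]]]] _ //; rewrite /word_tail /=.
- by rewrite mul1r.
(* Y X Y^2 X reduces to Y X^2 Y^2 and Y X Y X Y modulo Y X s2. *)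
have h : S (Y * X * s2).
  rewrite -[X in S X]mulr1; apply: S_polar; rewrite ?mulr1 //.
  - by do ?apply: SYr.
  - by do ?apply: SYr.
  - exact: SYr.
have -> : Y * X * Y * Y * X = Y * X * s2 - Y * X * X * Y * Y - Y * X * Y * X * Y.
  by rewrite /s2 !mulrDr !mulrA addrK addrK.
by apply: SB; [apply: SB => // |]; do ?apply: SYr.
Qed.

Lemma module_spanM A B : S A -> S B -> S (A * B).
Proof.
move=> SA [c Qc ->]; rewrite mulr_sumr; apply: module_span_sum => i.
rewrite mulr_sumr; apply: module_span_sum => j; rewrite -scalerAr.
apply: module_spanZ => //; rewrite mulrA.
have SAX : S (A * X ^+ i).
  by elim: (i : nat) => [|n IH]; rewrite ?mulr1 // exprSr mulrA; apply: SXr.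
have := ltn_ord j; move: (j : nat) => n.
case: n => [|[|[|[|[|[|//]]]]]] _; rewrite /word_tail /= ?mulr1 ?mulrA //;
  by do ?[apply: SXr | apply: SYr].
Qed.

Let QI a b : Q (a + b) -> Q a -> Q b.
Proof. by move=> Qab /(QB Qab); rewrite addrC addKr. Qed.

(** Traces are compared up to cyclic rotation of the words. *)
Ltac cyc := rewrite ?mulrA; first [done | (rewrite trC ?mulrA; done)
  | (do 2!rewrite trC ?mulrA; done) | (do 3!rewrite trC ?mulrA; done)
  | (do 4!rewrite trC ?mulrA; done) | (do 5!rewrite trC ?mulrA; done)].

Ltac rot := rewrite [LHS]trC !mulrA.
Ltac cyceq := rewrite ?mulrA; first [done | (rot; done) | (do 2!rot; done)
  | (do 3!rot; done) | (do 4!rot; done) | (do 5!rot; done)].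

Let QcubeX M : Q (\tr (X * X * M)) -> Q (\tr (X * M)) -> Q (\tr M) ->
  Q (\tr (X * X * X * M)).
Proof.
have [a [b [d [Qa Qb Qd ->]]]] := cube QX1 QX2 QX3 => h2 h1 h0.
rewrite !mulrDl -!scalerAl mul1r !mxtraceD !mxtraceZ.
by do ?apply: QD; apply: QM.
Qed.

Let QcubeY M : Q (\tr (Y * Y * M)) -> Q (\tr (Y * M)) -> Q (\tr M) ->
  Q (\tr (Y * Y * Y * M)).
Proof.
have [a [b [d [Qa Qb Qd ->]]]] := cube QY1 QY2 QY3 => h2 h1 h0.
rewrite !mulrDl -!scalerAl mul1r !mxtraceD !mxtraceZ.
by do ?apply: QD; apply: QM.
Qed.

Let QX3Y : Q (\tr (X * X * X * Y)). Proof. exact: QcubeX. Qed.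
Let QX3YY : Q (\tr (X * X * X * Y * Y)).
Proof. by rewrite -mulrA; apply: QcubeX; cyc. Qed.
Let QY3X : Q (\tr (Y * Y * Y * X)). Proof. by apply: QcubeY; cyc. Qed.
Let QY3XX : Q (\tr (Y * Y * Y * X * X)).
Proof. by rewrite -mulrA; apply: QcubeY; cyc. Qed.
Let QX3Y3 : Q (\tr (X * X * X * Y * Y * Y)).
Proof. by rewrite -!(mulrA (X * X * X)); apply: QcubeX; cyc. Qed.

Let QXYXY : Q (\tr (X * Y * X * Y)).
Proof.
have : Q (\tr (X * X * Y * Y) + \tr (X * Y * X * Y) + \tr (Y * X * X * Y)).
  by apply: Q_polar; cyc.
rewrite addrAC => /QI; apply; apply: QD => //; cyc.
Qed.

Let QXXYXY : Q (\tr (X * X * Y * X * Y)).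
Proof.
have : Q (\tr (X * X * Y * (X * Y)) + \tr (X * Y * X * (X * Y))
    + \tr (Y * X * X * (X * Y))) by apply: Q_polar; cyc.
have -> : \tr (X * Y * X * (X * Y)) = \tr (X * X * Y * X * Y) by cyceq.
have -> : \tr (X * X * Y * (X * Y)) = \tr (X * X * Y * X * Y) by cyceq.
rewrite addrC => /QI h; apply: Q2I; rewrite mulr_natl mulr2n.
by apply: h; cyc.
Qed.

Let QXYXYY : Q (\tr (X * Y * X * Y * Y)).
Proof.
have : Q (\tr (Y * Y * X * (Y * X)) + \tr (Y * X * Y * (Y * X))
    + \tr (X * Y * Y * (Y * X))) by apply: Q_polar; cyc.
have -> : \tr (Y * Y * X * (Y * X)) = \tr (X * Y * X * Y * Y).
  by cyceq.
have -> : \tr (Y * X * Y * (Y * X)) = \tr (X * Y * X * Y * Y).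
  by cyceq.
rewrite addrC => /QI h; apply: Q2I; rewrite mulr_natl mulr2n.
by apply: h; cyc.
Qed.

Notation w := (\tr (X * X * Y * X * Y * Y)).
Notation w' := (\tr (X * X * Y * Y * X * Y)).

(** The two traces of degree (3,3) that are exchanged by reversal of words have
    their sum in Q. *)
Let Qww' : Q (w + w').
Proof.
have : Q (\tr (Y * Y * X * (Y * X * X)) + \tr (Y * X * Y * (Y * X * X))
    + \tr (X * Y * Y * (Y * X * X))) by apply: Q_polar; cyc.
have -> : \tr (Y * Y * X * (Y * X * X)) = w' by cyceq.
have -> : \tr (Y * X * Y * (Y * X * X)) = w by cyceq.
by rewrite addrC [w' + w]addrC => /QI; apply; cyc.
Qed.

Let Z := X * Y - Y * X.

Let trZ : \tr Z = 0. Proof. by rewrite /Z raddfB /= trC subrr. Qed.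

Let trZ2 : \tr (Z * Z) = 2 * (\tr (X * Y * X * Y) - \tr (X * X * Y * Y)).
Proof.
rewrite /Z mulrBl !mulrBr !mulrA !raddfB /=.
have -> : \tr (Y * X * Y * X) = \tr (X * Y * X * Y) by cyceq.
have -> : \tr (X * Y * Y * X) = \tr (X * X * Y * Y) by cyceq.
have -> : \tr (Y * X * X * Y) = \tr (X * X * Y * Y) by cyceq.
ring.
Qed.

Let trZ3 : \tr (Z * Z * Z) = 3 * (w' - w).
Proof.
rewrite /Z !(mulrBl, mulrBr) !mulrA !raddfB /=.
have -> : \tr (Y * X * Y * X * Y * X) = \tr (X * Y * X * Y * X * Y) by cyceq.
have -> : \tr (X * Y * X * Y * Y * X) = w by cyceq.
have -> : \tr (X * Y * Y * X * X * Y) = w by cyceq.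
have -> : \tr (Y * X * X * Y * X * Y) = w by cyceq.
have -> : \tr (X * Y * Y * X * Y * X) = w' by cyceq.
have -> : \tr (Y * X * X * Y * Y * X) = w' by cyceq.
have -> : \tr (Y * X * Y * X * X * Y) = w' by cyceq.
ring.
Qed.

(** Up to a factor and an element of Q, w is the determinant of the commutator Z,
    and Cayley-Hamilton expresses this scalar matrix through powers of Z. *)
Let Sw : S (w *: 1).
Proof.
have SZ : S Z by apply: SB; apply: module_spanM.
have QZ2 : Q (\tr (Z * Z)) by rewrite trZ2; apply: QM => //; apply: QB.
have := cayley_hamilton_polar Z Z; rewrite trZ trZ3.
rewrite !(mulr0, mul0r, expr0n, scale0r, add0r, sub0r, opprK, subr0) /=.
(* CH expresses tr(Z^3) = 3 (w' - w) through Z and Z^3; together with w + w' in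
   Q this determines w. *)
move=> CH; have : S (2 *: (Z * Z * Z + Z * Z * Z + Z * Z * Z)).
  by apply: module_spanZ => //; do ?apply: module_spanD; do ?apply: module_spanM.
rewrite {}CH => /SI h; have {h} : S ((2 * (3 * (w' - w))) *: 1).
  apply: h; apply: SB; [apply: SN|]; apply: module_spanZ => //; last exact: QN.
  by apply: QM => //; apply: QN.
move=> Sdiff; have : S ((2 * 3 * (w + w')) *: 1).
  by apply: module_spanZ => //; apply: QM => //; apply: QM.
move=> /SB/(_ Sdiff); rewrite -scalerBl.
have -> : 2 * 3 * (w + w') - 2 * (3 * (w' - w)) = 2 * (2 * (3 * w)) by ring.
rewrite -!(scalerA 2) => /S2I/S2I/(module_spanZ Q3V).
by rewrite scalerA mulKr.
Qed.

(** Seventeen of the eighteen basis words have their trace in Q, and the last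
    trace is w. *)
Lemma module_span_trace A : S A -> S (\tr A *: 1).
Proof.
move=> [c Qc ->]; rewrite raddf_sum scaler_suml; apply: module_span_sum => i.
rewrite raddf_sum scaler_suml; apply: module_span_sum => j.
rewrite /= mxtraceZ -scalerA; apply: module_spanZ => //.
have QS q : Q q -> S (q *: 1) by move=> Qq; apply: module_spanZ.
have Q3' : Q (\tr (1 : 'M[R]_3)) by rewrite mxtrace1.
have := ltn_ord i; have := ltn_ord j; move: (i : nat) (j : nat) => m n.
case: n => [|[|[|[|[|[|//]]]]]] _; case: m => [|[|[|//]]] _;
  rewrite /word_tail /= ?expr0 ?expr1 ?expr2 ?mul1r ?mulr1 ?mulrA;
  first [exact: Sw | by apply: QS; cyc].
Qed.

End Span.

(** * The Jacobian criterion *)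

(** The chain rule. *)
Lemma mderiv_comp_mpoly (R : comNzRingType) n k (lq : n.-tuple {mpoly R[k]})
    (p : {mpoly R[n]}) (l : 'I_k) :
  (p \mPo lq)^`M(l) = \sum_(i < n) (p^`M(i) \mPo lq) * (tnth lq i)^`M(l).
Proof.
elim/mpolyind: p => [|c m p _ _ IHp].
  by rewrite comp_mpoly0 mderiv0 big1 // => i _; rewrite mderiv0 comp_mpoly0 mul0r.
rewrite comp_mpolyD mderivD IHp comp_mpolyZ mderivZ.
have {IHp} X_m : ('X_[m] \mPo lq)^`M(l)
    = \sum_(i < n) ('X_[m]^`M(i) \mPo lq) * (tnth lq i)^`M(l).
  pose ok (q : {mpoly R[n]}) := (q \mPo lq)^`M(l)
    = \sum_(i < n) (q^`M(i) \mPo lq) * (tnth lq i)^`M(l).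
  have okM q r : ok q -> ok r -> ok (q * r).
    move=> okq okr; rewrite /ok rmorphM /= mderivM okq okr mulr_suml mulr_sumr.
    rewrite -big_split; apply: eq_bigr => i _.
    by rewrite mderivM comp_mpolyD !rmorphM /=; ring.
  have ok1 : ok 1.
    rewrite /ok comp_mpoly1 -[1]/(1%:MP) mderivC big1 // => i _.
    by rewrite -[1]/(1%:MP) mderivC comp_mpoly0 mul0r.
  rewrite mpolyXE_id -/(ok _); elim/big_rec: _ => [|i q _ okq]; first exact: ok1.
  apply: (okM) okq; elim: (m i) => [|d IHd]; first by rewrite expr0; exact: ok1.
  rewrite exprS; apply: okM IHd.
  rewrite /ok comp_mpolyXU -tnth_nth (bigD1 i) //= mderivX mnm1E eqxx scale1r.
  rewrite (_ : U_(i) - U_(i) = 0)%MM; last first.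
    by apply/mnmP => j; rewrite mnmBE mnm0E subnn.
  rewrite mpolyX0 comp_mpoly1 mul1r big1 ?addr0 // => j /negPf ji.
  by rewrite mderivX mnm1E eq_sym ji scale0r comp_mpoly0 mul0r.
rewrite X_m scaler_sumr -big_split; apply: eq_bigr => i _.
by rewrite mderivD mderivZ comp_mpolyD comp_mpolyZ mulrDl scalerAl.
Qed.

(** A polynomial determinant that is nonzero at one point is nonzero, hence
    regular. *)
Lemma row_free_specialization (F : fieldType) n k d (v : 'I_k -> F)
    (J : 'M[{mpoly F[k]}]_(n, d)) (q : 'rV_n) :
  row_free (map_mx (meval v) J) -> q *m J = 0 -> q = 0.
Proof.
move=> /row_freeP[B JB] qJ; pose M := J *m map_mx (@mpolyC k F) B.
have dM : \det M != 0.
  have : (\det M).@[v] != 0.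
    rewrite -det_map_mx map_mxM (_ : map_mx _ J *m _ = 1%:M) ?det1 ?oner_neq0 //.
    rewrite -[RHS]JB; congr (_ *m _); apply/matrixP => a b; rewrite !mxE.
    exact: mevalC.
  by apply: contraNneq => ->; rewrite meval0.
have : q *m M *m \adj M = 0 by rewrite /M mulmxA qJ !mul0mx.
rewrite -mulmxA mul_mx_adj mul_mx_scalar => /rowP qE; apply/rowP => i.
by move/eqP: (qE i); rewrite !mxE mulf_eq0 (negPf dM) => /eqP.
Qed.

(** By the chain rule and the independence of the gradients, the partial
    derivatives of a relation among the tau_i are again relations. By descent on
    the degree they vanish, so in characteristic 0 the relation is constant. *)
Lemma jacobian_criterion (F : fieldType) n k (tau : n.-tuple {mpoly F[k]})
    (v : 'I_k -> F) :
  [pchar F] =i pred0 ->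
  row_free (\matrix_(i < n, l < k) ((tnth tau i)^`M(l)).@[v]) ->
  forall p : {mpoly F[n]}, p \mPo tau = 0 -> p = 0.
Proof.
move=> charF0 free p ptau; pose J : 'M_(n, k) := \matrix_(i, l) (tnth tau i)^`M(l).
have deriv0 (q : {mpoly F[n]}) : q \mPo tau = 0 -> forall i, q^`M(i) \mPo tau = 0.
  move=> qtau i; pose r := \row_i (q^`M(i) \mPo tau).
  have rJ : r *m J = 0.
    apply/rowP => l; rewrite !mxE; transitivity ((q \mPo tau)^`M(l)).
      rewrite mderiv_comp_mpoly.
      by apply: eq_bigr => i' _; rewrite !mxE.
    by rewrite qtau mderiv0.
  suff /rowP/(_ i) : r = 0 by rewrite !mxE.
  apply: (row_free_specialization (v := v) _ rJ).
  rewrite (_ : map_mx _ J = \matrix_(i, l) ((tnth tau i)^`M(l)).@[v]) //.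
  by apply/matrixP => a b; rewrite !mxE.
suff low N (q : {mpoly F[n]}) : (forall m, (N <= mdeg m)%N -> q@_m = 0) ->
    q \mPo tau = 0 -> q = 0.
  apply: (low (msize p)) => // m le_m; apply/eqP; rewrite mcoeff_eq0.
  exact: msize_mdeg_ge.
elim: N q => [|N IHN] q qN qtau; first by apply/mpolyP => m; rewrite qN ?mcoeff0.
have dq i : q^`M(i) = 0.
  apply: IHN; last exact: deriv0.
  by move=> m le_m; rewrite mcoeff_mderiv qN ?mul0rn // mdegD mdeg1 addn1.
have qC : q = (q@_0)%:MP.
  apply/mpolyP => m; rewrite mcoeffC; case: (eqVneq m 0%MM) => [->|m0].
    by rewrite mulr1.
  rewrite mulr0; have [i mi] : exists i, m i != 0%N.
    apply/existsP; apply: contraNT m0; rewrite negb_exists => /forallP m0.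
    by apply/eqP/mnmP => i; rewrite mnm0E; apply/eqP; rewrite -[_ == _]negbK m0.
  have := congr1 (mcoeff (m - U_(i))%MM) (dq i).
  rewrite mcoeff_mderiv mcoeff0 submK ?lep1mP // => /eqP.
  by rewrite -mulr_natr mulf_eq0 (pcharf0P _).1 // orbF => /eqP.
move: qtau; rewrite {1}qC comp_mpolyC => /eqP; rewrite mpolyC_eq0 => /eqP q0.
by rewrite qC q0 mpolyC0.
Qed.

(** * The words at the base point *)

Section Point.
Variable F : fieldType.
Hypothesis charF0 : [pchar F] =i pred0.

Let nat_neq0 n : (n.+1%:R : F) != 0.
Proof. by rewrite (pcharf0P _).1. Qed.

Lemma cancel_nat n (a : F) : n.+1%:R * a = 0 -> a = 0.
Proof. by move/eqP; rewrite mulf_eq0 (negPf (nat_neq0 n)) => /eqP. Qed.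

(** The indices 'I_3 are read modulo 3, so that the shift by e = 1 and its
    transpose, the shift by e = -1, are cyclic permutation matrices. The diagonal
    entries 0, 1, -1 are distinct, and this choice also keeps the equations of
    [tau_alg_independent] nonsingular. *)
Definition point (i : 'I_3) : F := [:: 0; 1; -1]`_i.
Definition point_mx : 'M[F]_3 := \matrix_(i, j) (point i *+ (i == j)).
Definition shift_mx (e : 'I_3) : 'M[F]_3 := \matrix_(i, j) (j == i + e)%:R.

Lemma ord3P (G : 'I_3 -> Prop) : G 0 -> G 1 -> G (-1) -> forall i, G i.
Proof.
move=> G0 G1 G2 i; have : [|| i == 0, i == 1 | i == -1] by case: i => [[|[|[|]]]].
by case/or3P => /eqP ->.
Qed.

Lemma point_mx_mul (M : 'M[F]_3) i j : (point_mx * M) i j = point i * M i j.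
Proof.
rewrite -mulmxE mxE (bigD1 i) //= big1 ?addr0 ?mxE ?eqxx ?mulr1n // => k.
by rewrite mxE eq_sym => /negPf ->; rewrite mulr0n mul0r.
Qed.

Lemma point_mx_exp_mul a (M : 'M[F]_3) i j :
  (point_mx ^+ a * M) i j = point i ^+ a * M i j.
Proof.
by elim: a => [|a IH]; rewrite ?mul1r // !exprS -!mulrA point_mx_mul IH.
Qed.

Lemma shift_mx_mul e (M : 'M[F]_3) i j : (shift_mx e * M) i j = M (i + e) j.
Proof.
rewrite -mulmxE mxE (bigD1 (i + e)) //= big1 ?addr0 ?mxE ?eqxx ?mul1r // => k.
by rewrite mxE => /negPf ->; rewrite mul0r.
Qed.

Lemma word_tail_point e (b : nat) i j : (b < 6)%N ->
  word_tail point_mx (shift_mx e) b i j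
  = [:: 1; 1; 1; point (i + e); point (i + e); point (i + e)]`_b
    * (j == i + [:: 0; e; e + e; e; e + e; e + e + e]`_b)%:R.
Proof.
rewrite /word_tail; case: b => [|[|[|[|[|[|//]]]]]] _ /=;
  rewrite -?mulrA ?(shift_mx_mul, point_mx_mul) ?mxE ?mul1r ?addr0 ?addrA //.
  by rewrite eq_sym.
by rewrite mulr_natr eq_sym.
Qed.

Lemma vandermonde_point (u : 'I_3 -> F) :
  (forall i, \sum_(a < 3) u a * point i ^+ a = 0) -> forall a, u a = 0.
Proof.
have sumE i : \sum_(a < 3) u a * point i ^+ a
    = u 0 + u 1 * point i + u (-1) * point i ^+ 2.
  rewrite sum3 expr0 mulr1 expr1; congr (_ + u _ * _); exact: val_inj.
move=> u0; have := u0 0; rewrite sumE [point 0]/(0 : F) mulr0 expr0n mulr0 !addr0 => e0.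
have := u0 1; rewrite sumE [point 1]/(1 : F) e0 add0r expr1n !mulr1 => e1.
have := u0 (-1); rewrite sumE [point (-1)]/(-1 : F) e0 add0r sqrrN expr1n mulrN !mulr1 => e2.
apply: ord3P => //; apply: (@cancel_nat 1).
  by rewrite -[RHS](subrr 0) -{1}e1 -e2; ring.
by rewrite -[RHS](addr0 0) -{1}e1 -e2; ring.
Qed.

Let point_inj i : point (i + 1) - point (i - 1) != 0.
Proof.
have p0 : point 0 = 0 by []. have p1 : point 1 = 1 by []. have p2 : point (-1) = -1 by [].
move: i; apply: ord3P.
- rewrite add0r sub0r p1 p2 opprK; exact: (nat_neq0 1).
- by rewrite subrr p0 (_ : 1 + 1 = -1) ?p2 ?subr0 ?oppr_eq0 ?oner_neq0 //; apply: val_inj.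
- rewrite addNr p0 (_ : -1 - 1 = 1) ?p1 ?sub0r ?oppr_eq0 ?oner_neq0 //.
  exact: val_inj.
Qed.

(** For each s among the three diagonal entries, u(s) + w(s) t vanishes at the two
    other entries t, which forces u(s) = w(s) = 0; and polynomials of degree at
    most 2 are determined by their values at three points. *)
Let two_point_interpolation (u w : 'I_3 -> F) :
  (forall i e : 'I_3, e \in [:: 1; -1] ->
    \sum_(a < 3) point i ^+ a * (u a + w a * point (i + e)) = 0) ->
  (forall a, u a = 0) /\ (forall a, w a = 0).
Proof.
move=> uw; pose U i := \sum_(a < 3) u a * point i ^+ a; pose W i := \sum_(a < 3) w a * point i ^+ a.
have UW i e : e \in [:: 1; -1] -> U i + W i * point (i + e) = 0.
  move=> e1; rewrite -(uw i e e1) mulr_suml -big_split.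
  by apply: eq_bigr => a _ /=; ring.
have W0 i : W i = 0.
  have : W i * (point (i + 1) - point (i - 1)) = 0.
    have e1 := UW i 1 (mem_head _ _); have e2 := UW i (-1) isT.
    by rewrite -[RHS](subrr 0) -{1}e1 -e2; ring.
  by move/eqP; rewrite mulf_eq0 (negPf (point_inj i)) orbF => /eqP.
split; apply: vandermonde_point => // i.
by have := UW i 1 (mem_head _ _); rewrite W0 mul0r addr0.
Qed.

(** A dependency gives, on each shifted diagonal, a polynomial u(s) + w(s) t that
    vanishes at all pairs of distinct diagonal entries (s, t): the shift by 1 gives
    one half of these ordered pairs and the shift by -1 the other half. *)
Lemma words_free_at_point (c : 'I_3 -> 'I_6 -> F) :
  (forall e : 'I_3, e \in [:: 1; -1] ->
    \sum_i \sum_j c i j *: (point_mx ^+ i * word_tail point_mx (shift_mx e) j) = 0) ->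
  forall i j, c i j = 0.
Proof.
move=> c0.
(* The words whose Y-degree is r mod 3 live on the r-th shifted diagonal. *)
have diag (p q : 'I_6) : (p, q) \in [:: (0, 5); (1, 3); (2, 4)] ->
    (forall a, c a p = 0) /\ (forall a, c a q = 0).
  move=> pq; apply: two_point_interpolation => i e e1.
  pose off b := [:: 0; e; e + e; e; e + e; e + e + e]`_b.
  have offE (j : 'I_6) : (off p == off j) = (j == p) || (j == q).
    move: e1 pq; rewrite !inE /off => /orP[]/eqP-> /or3P[]/eqP[-> ->];
    by case: j => [[|[|[|[|[|[|//]]]]]] ?].
  have qp : q != p by move: pq; rewrite !inE => /or3P[]/eqP[-> ->].
  transitivity ((\sum_i \sum_j c i j *: (point_mx ^+ i
      * word_tail point_mx (shift_mx e) j)) i (i + off p)); last by rewrite c0 // mxE.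
  rewrite summxE; apply: eq_bigr => a _; rewrite summxE.
  rewrite (bigD1 p) //= (bigD1 q) //= big1 ?addr0; last first.
    move=> j /andP[jp jq]; rewrite mxE point_mx_exp_mul word_tail_point //.
    by rewrite (inj_eq (addrI i)) offE (negPf jp) (negPf jq) !mulr0.
  rewrite [X in _ = X + _]mxE [X in _ = _ + X]mxE !point_mx_exp_mul !word_tail_point // !(inj_eq (addrI i)) !offE !eqxx orbT orTb.
  have [-> ->] : [:: 1; 1; 1; point (i + e); point (i + e); point (i + e)]`_p = 1 /\
    [:: 1; 1; 1; point (i + e); point (i + e); point (i + e)]`_q = point (i + e).
    by move: pq; rewrite !inE => /or3P[]/eqP[-> ->].
  by rewrite /= !mulr1; ring.
move=> i j; case: j => [[|[|[|[|[|[|//]]]]]] lt_j].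
- rewrite (_ : Ordinal lt_j = 0); last exact: val_inj.
  by have [] := diag 0 5 isT.
- rewrite (_ : Ordinal lt_j = 1); last exact: val_inj.
  by have [] := diag 1 3 isT.
- rewrite (_ : Ordinal lt_j = 2); last exact: val_inj.
  by have [] := diag 2 4 isT.
- rewrite (_ : Ordinal lt_j = 3); last exact: val_inj.
  by have [] := diag 1 3 isT.
- rewrite (_ : Ordinal lt_j = 4); last exact: val_inj.
  by have [] := diag 2 4 isT.
- rewrite (_ : Ordinal lt_j = 5); last exact: val_inj.
  by have [] := diag 0 5 isT.
Qed.

End Point.

(** * Algebraic independence of the ten traces *)

Section Generic.
Variable F : fieldType.
Hypothesis charF0 : [pchar F] =i pred0.
Notation P := {mpoly F[2 * (3 * 3)]}.
Notation X := (gen_mx F ord0).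
Notation Y := (gen_mx F ord_max).

Definition matrix_point (R : Type) (M : 'I_2 -> 'M[R]_3) : 'I_(2 * (3 * 3)) -> R :=
  fun l => mxvec (\matrix_(k, l') mxvec (M k) 0 l') 0 l.

Lemma meval_gen_mx (M : 'I_2 -> 'M[F]_3) k : map_mx (meval (matrix_point M)) (gen_mx F k) = M k.
Proof.
by apply/matrixP => i j; rewrite !mxE mevalXU /matrix_point mxvecE mxE mxvecE.
Qed.

Lemma gvar_inj k i j k' i' j' :
  (gvar k i j == gvar k' i' j') = [&& k == k', i == i' & j == j'].
Proof.
have vec_inj m n (a a' : 'I_m) (b b' : 'I_n) :
    (mxvec_index a b == mxvec_index a' b') = (a == a') && (b == b').
  apply/eqP/andP => [|[/eqP -> /eqP ->] //].
  case: (curry_mxvec_bij m n) => g gK _ /(congr1 g).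
  by rewrite (gK (a, b)) // (gK (a', b')) // => -[-> ->].
by rewrite /gvar !vec_inj.
Qed.

(** Each of the ten generating traces is tr(X^a Y^b) for one of these (a, b). *)
Definition trace_exp (k : nat) : nat * nat := nth (0, 0)%N
  [:: (1, 0); (2, 0); (3, 0); (0, 1); (1, 1); (2, 1); (0, 2); (1, 2); (2, 2);
      (0, 3)]%N k.

Definition trace_gen (R : pzRingType) (A B : 'M[R]_3) (k : nat) : R :=
  \tr (A ^+ (trace_exp k).1 * B ^+ (trace_exp k).2).

Definition tau : 10.-tuple P := [tuple trace_gen X Y k | k < 10].

Definition deriv_mx l (A : 'M[P]_3) : 'M[P]_3 := map_mx (mderiv l) A.

Lemma deriv_mxM l A B : deriv_mx l (A * B) = deriv_mx l A * B + A * deriv_mx l B.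
Proof.
rewrite -!mulmxE; apply/matrixP => i j; rewrite !mxE raddf_sum -big_split.
by apply: eq_bigr => k _; rewrite /= mderivM !mxE.
Qed.

Lemma deriv_mx_tr l A : (\tr A)^`M(l) = \tr (deriv_mx l A).
Proof. by rewrite raddf_sum; apply: eq_bigr => i _; rewrite mxE. Qed.

Lemma deriv_mx1 l : deriv_mx l 1 = 0.
Proof.
apply/matrixP => i j; rewrite !mxE; case: eqP => _; last by rewrite mderiv0.
by rewrite -[1]/(1%:MP) mderivC.
Qed.

Lemma deriv_gen_mx k k' i j : deriv_mx (gvar k i j) (gen_mx F k')
  = if k == k' then delta_mx i j else 0.
Proof.
apply/matrixP => a b; rewrite !mxE mderivX mnm1E gvar_inj.
case: (eqVneq k k') => [->|kk']; last first.
  by rewrite mxE scale0r.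
rewrite mxE /=.
case: andP => [[/eqP -> /eqP ->]|_]; last by rewrite scale0r.
rewrite scale1r (_ : U_(_) - U_(_) = 0)%MM ?mpolyX0 //.
by apply/mnmP => c; rewrite mnmBE mnm0E subnn.
Qed.

Lemma deriv_mx_evalM v l A B : map_mx (meval v) (deriv_mx l (A * B))
  = map_mx (meval v) (deriv_mx l A) * map_mx (meval v) B
  + map_mx (meval v) A * map_mx (meval v) (deriv_mx l B).
Proof. by rewrite deriv_mxM map_mxD -!mulmxE !map_mxM. Qed.

Lemma mxtrace_mul_delta (R : pzRingType) (M : 'M[R]_3) i j :
  \tr (M * delta_mx i j) = M j i.
Proof.
rewrite /mxtrace (bigD1 j) //= -mulmxE mxE (bigD1 i) //= mxE !eqxx mulr1.
rewrite !big1 ?addr0 // => k kN; last by rewrite mxE (negPf kN) mulr0.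
by rewrite mxE big1 // => l _; rewrite mxE (negPf kN) andbF mulr0.
Qed.

Lemma derivation_words (A B : pzRingType) (ev d : A -> B) (x y : A) a b :
  {morph ev : u v / u * v} -> ev 1 = 1 ->
  (forall u v, d (u * v) = d u * ev v + ev u * d v) -> d 1 = 0 -> d x = 0 ->
  d (x ^+ a * y ^+ b)
  = ev x ^+ a * \sum_(s < b) ev y ^+ s * d y * ev y ^+ (b.-1 - s).
Proof.
move=> evM ev1 dM d1 dx.
have evX u n : ev (u ^+ n) = ev u ^+ n.
  by elim: n => [|n IH]; rewrite ?expr0 // !exprS evM IH.
have dxn n : d (x ^+ n) = 0.
  by elim: n => [|n IH]; rewrite ?expr0 // exprS dM dx IH mul0r mulr0 addr0.
rewrite dM dxn mul0r add0r evX; congr (_ * _).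
elim: b => [|b IH]; first by rewrite big_ord0.
rewrite exprS dM IH big_ord_recl mul1r subn0 evX; congr (_ + _).
rewrite mulr_sumr; apply: eq_bigr => s _; rewrite exprS !mulrA; congr (_ * _ ^+ _).
by rewrite lift0 -[b.+1.-1]/b; lia.
Qed.

Notation D := (point_mx F).
Notation C := (shift_mx F 1).
Definition base_point : 'I_(2 * (3 * 3)) -> F :=
  matrix_point (fun k => if k == ord0 then D else C).

Let evX : map_mx (meval base_point) X = D. Proof. by rewrite meval_gen_mx. Qed.
Let evY : map_mx (meval base_point) Y = C. Proof. by rewrite meval_gen_mx. Qed.

Let ev (A : 'M[P]_3) : 'M[F]_3 := map_mx (meval base_point) A.
Let evalM : {morph ev : A B / A * B}.
Proof. by move=> A B; rewrite /ev -!mulmxE map_mxM. Qed.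
Let ev1 : ev 1 = 1. Proof. exact: map_mx1. Qed.
Let d l (A : 'M[P]_3) : 'M[F]_3 := map_mx (meval base_point) (deriv_mx l A).
Let d1 l : d l 1 = 0. Proof. by rewrite /d deriv_mx1 map_mx0. Qed.
Let dM l A B : d l (A * B) = d l A * ev B + ev A * d l B.
Proof. exact: deriv_mx_evalM. Qed.
Let mxtrace_ev A : (\tr A).@[base_point] = \tr (ev A).
Proof. by rewrite raddf_sum; apply: eq_bigr => i _; rewrite mxE. Qed.
Let trC (A B : 'M[F]_3) : \tr (A * B) = \tr (B * A).
Proof. by rewrite -!mulmxE mxtrace_mulC. Qed.
Let dE k i j : d (gvar k i j) (gen_mx F k) = delta_mx i j.
Proof. by rewrite /d deriv_gen_mx eqxx map_delta_mx. Qed.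

(** Rotating each term of d tr(X^a Y^b) until dY comes last gives the gradient. *)
Lemma jacobian_Y a b i j :
  ((\tr (X ^+ a * Y ^+ b))^`M(gvar ord_max i j)).@[base_point]
  = (\sum_(s < b) C ^+ (b.-1 - s) * D ^+ a * C ^+ s) j i.
Proof.
rewrite deriv_mx_tr mxtrace_ev -[ev _]/(d (gvar ord_max i j) (X ^+ a * Y ^+ b)).
rewrite (derivation_words Y a b evalM ev1 (dM _) (d1 _)).
  rewrite [ev X]evX [ev Y]evY dE mulr_sumr raddf_sum summxE; apply: eq_bigr => s _ /=.
  by rewrite mulrA trC !mulrA mxtrace_mul_delta.
by rewrite /d deriv_gen_mx map_mx0.
Qed.

Lemma jacobian_X a i j :
  ((\tr (X ^+ a))^`M(gvar ord0 i j)).@[base_point] = a%:R * (D ^+ a.-1) j i.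
Proof.
rewrite deriv_mx_tr mxtrace_ev -[ev _]/(d (gvar ord0 i j) (X ^+ a)) -[X ^+ a]mul1r -(expr0 1).
rewrite (derivation_words X 0 a evalM ev1 (dM _) (d1 _) (d1 _)).
rewrite [ev X]evX dE expr0 mul1r raddf_sum /=.
transitivity (\sum_(s < a) (D ^+ a.-1) j i).
  apply: eq_bigr => s _; rewrite trC mulrA -exprD mxtrace_mul_delta subnK //.
  by have := ltn_ord s; lia.
by rewrite sumr_const card_ord mulr_natl.
Qed.

Let sum10 (G : nat -> F) : \sum_(k < 10) G k
  = G 0%N + G 1%N + G 2%N + G 3%N + G 4%N + G 5%N + G 6%N + G 7%N + G 8%N + G 9%N.
Proof. by rewrite !big_ord_recr big_ord0 /= add0r. Qed.

Let jacobian_col (j i : 'I_3) : seq F :=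
  [:: 0; 0; 0; (i == j)%:R; point F j * (i == j)%:R; point F j ^+ 2 * (i == j)%:R;
      2 * (i == j + 1)%:R; (point F (j + 1) + point F j) * (i == j + 1)%:R;
      (point F (j + 1) ^+ 2 + point F j ^+ 2) * (i == j + 1)%:R;
      3 * (i == j + 1 + 1)%:R].

Let jacobian_YE k (j i : 'I_3) : (k < 10)%N ->
  ((trace_gen X Y k)^`M(gvar ord_max i j)).@[base_point] = (jacobian_col j i)`_k.
Proof.
move=> lt_k; rewrite /jacobian_col /trace_gen jacobian_Y.
have mxD (M N : 'M[F]_3) : (M + N) j i = M j i + N j i by rewrite mxE.
have m1 a b : (1 : 'M[F]_3) a b = (b == a)%:R by rewrite mxE eq_sym.
have De a : (D ^+ a) j i = point F j ^+ a * (i == j)%:R.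
  by rewrite -[D ^+ a]mulr1 point_mx_exp_mul m1.
have Ce : C j i = (i == j + 1)%:R by rewrite mxE.
have CDe a : (C * D ^+ a) j i = point F (j + 1) ^+ a * (i == j + 1)%:R.
  by rewrite shift_mx_mul -[D ^+ a]mulr1 point_mx_exp_mul m1.
have DCe a : (D ^+ a * C) j i = point F j ^+ a * (i == j + 1)%:R.
  by rewrite point_mx_exp_mul Ce.
have CCe : (C * C) j i = (i == j + 1 + 1)%:R by rewrite shift_mx_mul mxE.
have C1 : C ^+ (1 - 0) = C by rewrite subn0 expr1.
have C2 : C ^+ (2 - 0) = C * C by rewrite subn0 expr2.
have C21 : C ^+ (2 - 1) = C by [].
case: k lt_k => [|[|[|[|[|[|[|[|[|[|//]]]]]]]]]] _; rewrite /trace_exp /=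
  !(big_ord_recr, big_ord0) ?add0r /= ?expr0 ?mul1r ?mulr1 ?add0r ?C1 ?C2 ?C21
  ?(expr1 C) -?(expr2 C) ?mxD ?De ?CDe ?DCe ?expr2 ?CCe ?Ce ?m1 ?expr1 ?mxE //; ring.
Qed.

(** At the base point the derivatives with respect to Y are 1, X, X^2, 2Y, XY + YX,
    X^2 Y + Y X^2 and 3Y^2 for the traces that involve Y, and 0 for the others.
    These seven matrices are independent: they lie on three different shifted
    diagonals, and on each one they are told apart by the diagonal entries. The
    remaining traces tr(X^a) have the independent derivatives 1, 2X, 3X^2 with
    respect to X. *)
Lemma tau_alg_independent (p : {mpoly F[10]}) : p \mPo tau = 0 -> p = 0.
Proof.
apply: (@jacobian_criterion F 10 _ tau base_point charF0); apply: inj_row_free => u uJ.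
pose u' n := u 0 (inord n : 'I_10).
have uJl l : \sum_(k < 10) u' k * ((trace_gen X Y k)^`M(l)).@[base_point] = 0.
  move/rowP/(_ l): uJ; rewrite !mxE => uJl; rewrite -[RHS]uJl; apply: eq_bigr => k _.
  by rewrite mxE tnth_mktuple /u' inord_val.
have uY (j i : 'I_3) :
    (u' 3%N + u' 4%N * point F j + u' 5%N * point F j ^+ 2) * (i == j)%:R
    + (u' 6%N * 2 + u' 7%N * (point F (j + 1) + point F j)
       + u' 8%N * (point F (j + 1) ^+ 2 + point F j ^+ 2)) * (i == j + 1)%:R
    + 3 * u' 9%N * (i == j + 1 + 1)%:R = 0.
  have E (k : 'I_10) : true -> u' k * ((trace_gen X Y k)^`M(gvar ord_max i j)).@[base_point]
      = u' k * (jacobian_col j i)`_k.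
    by move=> _; rewrite jacobian_YE.
  rewrite -[RHS](uJl (gvar ord_max i j)) (eq_bigr _ E).
  by rewrite (sum10 (fun k => u' k * (jacobian_col j i)`_k)) /=; ring.
have [p0 p1 p2] : [/\ point F 0 = 0, point F 1 = 1 & point F (-1) = -1] by [].
have u9 : u' 9%N = 0.
  apply: (cancel_nat charF0 (n := 2)); rewrite -[RHS](uY 0 (0 + 1 + 1)) eqxx.
  rewrite (_ : (0 + 1 + 1 == 0 :> 'I_3) = false) // (_ : (0 + 1 + 1 == 0 + 1 :> 'I_3) = false) //.
  by rewrite /=; ring.
have diag a : (a < 3)%N -> u' (3 + a)%N = 0.
  move=> lt_a; apply: (vandermonde_point charF0 (u := fun a : 'I_3 => u' (3 + a)%N) _ (Ordinal lt_a)) => j.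
  rewrite sum3 /= -[RHS](uY j j) u9 mulr0 mul0r addr0 eqxx.
  rewrite (_ : (j == j + 1) = false); last by move: j; apply: ord3P.
  by rewrite expr0 expr1 /=; ring.
have u345 : [/\ u' 3%N = 0, u' 4%N = 0 & u' 5%N = 0].
  by split; [apply: (diag 0)|apply: (diag 1)|apply: (diag 2)].
have off j : u' 6%N * 2 + u' 7%N * (point F (j + 1) + point F j)
       + u' 8%N * (point F (j + 1) ^+ 2 + point F j ^+ 2) = 0.
  rewrite -[RHS](uY j (j + 1)) u9 eqxx.
  rewrite (_ : (j + 1 == j) = false); last by move: j; apply: ord3P.
  by have [-> -> ->] := u345; rewrite /=; ring.
have e0 := off 0; have e1 := off 1; have e2 := off (-1).
rewrite add0r p0 p1 in e0; rewrite addNr p0 p2 in e2.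
rewrite (_ : 1 + 1 = -1) ?p1 ?p2 in e1; last exact: val_inj.
have u7 : u' 7%N = 0.
  apply: (cancel_nat charF0 (n := 1)).
  by have := congr2 (fun a b => a - b) e0 e2; rewrite subrr => <-; ring.
have u8 : u' 8%N = 0.
  apply: (cancel_nat charF0 (n := 0)).
  by have := congr2 (fun a b => a - b) e1 e0; rewrite subrr u7 => <-; ring.
have u6 : u' 6%N = 0.
  by apply: (cancel_nat charF0 (n := 1)); move: e0; rewrite u7 u8 => <-; ring.
have uX (j : 'I_3) : u' 0%N * 1 + 2 * u' 1%N * point F j + 3 * u' 2%N * point F j ^+ 2 = 0.
  have E (k : 'I_10) : true -> u' k * ((trace_gen X Y k)^`M(gvar ord0 j j)).@[base_point]
      = u' k * [:: 1; 2 * point F j; 3 * point F j ^+ 2]`_k.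
    move=> _; case: k => [[|[|[|[|[|[|[|[|[|[|//]]]]]]]]]] ?];
      rewrite /= ?(diag 0%N isT) ?(diag 1%N isT) ?(diag 2%N isT) ?u6 ?u7 ?u8 ?u9 ?mul0r //.
    - rewrite /trace_gen /trace_exp /= expr0 mulr1 jacobian_X.
      by rewrite expr0 mxE eqxx !mulr1.
    - rewrite /trace_gen /trace_exp /= expr0 mulr1 jacobian_X.
      by rewrite -[D ^+ _]mulr1 point_mx_exp_mul mxE eqxx !mulr1.
    - rewrite /trace_gen /trace_exp /= expr0 mulr1 jacobian_X.
      by rewrite -[D ^+ _]mulr1 point_mx_exp_mul mxE eqxx !mulr1.
  rewrite -[RHS](uJl (gvar ord0 j j)) (eq_bigr _ E).
  rewrite (sum10 (fun k => u' k * [:: 1; 2 * point F j; 3 * point F j ^+ 2]`_k)) /=; ring.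
have low a : (a < 3)%N -> u' a = 0.
  move=> lt_a; apply: (cancel_nat charF0 (n := a)).
  apply: (vandermonde_point charF0 (u := fun a : 'I_3 => a.+1%:R * u' a) _ (Ordinal lt_a)) => i.
  by rewrite sum3 /= -[RHS](uX i) expr0 expr1 -[(1 %% 3)%N]/1%N; ring.
apply/rowP => k; rewrite mxE -[k]inord_val -/(u' k).
have := ltn_ord k; move: (k : nat) => {k} n.
case: n => [|[|[|n]]] lt_n; try exact: low.
case: n lt_n => [|[|[|[|[|[|[|//]]]]]]] _ //.
- exact: (diag 0%N).
- exact: (diag 1%N).
- exact: (diag 2%N).
Qed.

End Generic.

(** * Independence of the words *)

Section MapWord.
Variables (R S : comUnitRingType) (h : {rmorphism R -> S}).

Lemma map_mx_exp (A : 'M[R]_3) n : map_mx h (A ^+ n) = map_mx h A ^+ n.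
Proof.
elim: n => [|n IH]; first by rewrite !expr0 map_mx1.
by rewrite !exprS -IH -!mulmxE map_mxM.
Qed.

Lemma map_mx_mul (A B : 'M[R]_3) : map_mx h (A * B) = map_mx h A * map_mx h B.
Proof. by rewrite -!mulmxE map_mxM. Qed.

Lemma map_mx_word (A B : 'M[R]_3) i j : (j < 6)%N ->
  map_mx h (A ^+ i * word_tail A B j)
  = map_mx h A ^+ i * word_tail (map_mx h A) (map_mx h B) j.
Proof.
move=> lt_j; rewrite map_mx_mul map_mx_exp; congr (_ * _).
case: j lt_j => [|[|[|[|[|[|//]]]]]] _; rewrite /word_tail /= ?map_mx1 //.
- exact: map_mx_mul.
- exact: map_mx_mul.
- by rewrite !map_mx_mul.
- by rewrite !map_mx_mul.
Qed.

End MapWord.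

Section Free.
Variable F : fieldType.
Hypothesis charF0 : [pchar F] =i pred0.
Notation P := {mpoly F[2 * (3 * 3)]}.
Notation X := (gen_mx F ord0).
Notation Y := (gen_mx F ord_max).

Definition transpose_vars : (2 * (3 * 3)).-tuple P :=
  [tuple matrix_point (fun k => (gen_mx F k)^T) l | l < 2 * (3 * 3)].

Definition transpose_poly : {rmorphism P -> P} := comp_mpoly transpose_vars.

Lemma transpose_gen_mx k : map_mx transpose_poly (gen_mx F k) = (gen_mx F k)^T.
Proof.
apply/matrixP => i j; rewrite !mxE /transpose_poly /= comp_mpolyXU -tnth_nth.
by rewrite tnth_mktuple /matrix_point mxvecE mxE mxvecE !mxE.
Qed.

Let trmxX (A : 'M[P]_3) n : A^T ^+ n = (A ^+ n)^T.
Proof.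
elim: n => [|n IH]; first by rewrite !expr0 trmx1.
by rewrite exprSr exprS IH -!mulmxE trmx_mul.
Qed.

(** The traces tr(X^a Y^b) do not distinguish a pair of matrices from the pair of
    their transposes. *)
Lemma transpose_tau (p : {mpoly F[10]}) : transpose_poly (p \mPo tau F) = p \mPo tau F.
Proof.
rewrite [p \mPo _]comp_mpolyEX raddf_sum; apply: eq_bigr => m _.
rewrite /= comp_mpolyZ !comp_mpolyX rmorph_prod; congr (_ *: _).
apply: eq_bigr => k _; rewrite /= rmorphXn /=; congr (_ ^+ _).
rewrite tnth_mktuple /trace_gen; move: (trace_exp k).1 (trace_exp k).2 => a b.
have trT : \tr (X ^+ a * Y ^+ b) = \tr (X^T ^+ a * Y^T ^+ b).
  by rewrite !trmxX -!mulmxE -[RHS]mxtrace_tr trmx_mul !trmxK mxtrace_mulC.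
have trE A : transpose_poly (\tr A) = \tr (map_mx transpose_poly A).
  by rewrite raddf_sum; apply: eq_bigr => i _; rewrite [RHS]mxE.
rewrite -[LHS]/(transpose_poly (\tr (X ^+ a * Y ^+ b))) trE map_mx_mul !map_mx_exp.
rewrite (transpose_gen_mx ord0) (transpose_gen_mx ord_max).
exact: esym trT.
Qed.

(** Eighteen words in 3 x 3 matrices are dependent over the polynomials, but a
    dependency with coefficients in the ten traces persists when X and Y are
    replaced by their transposes. The two copies together give 18 equations, which
    are independent at the base point. *)
Lemma words_free (p : 'I_3 -> 'I_6 -> {mpoly F[10]}) :
  \sum_i \sum_j (p i j \mPo tau F) *: (X ^+ i * word_tail X Y j) = 0 ->
  forall i j, p i j = 0.
Proof.
move=> p0 i j; apply: (tau_alg_independent charF0).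
pose I := ('I_3 * 'I_6)%type; pose E := ('I_2 * ('I_3 * 'I_3))%type.
pose V (e : 'I_2) := if e == ord0 then X else X^T.
pose W (e : 'I_2) := if e == ord0 then Y else Y^T.
pose J : 'M[P]_(#|{: I}|, #|{: E}|) := \matrix_(a, b)
  let x := enum_val a : I in let y := enum_val b : E in
  (V y.1 ^+ x.1 * word_tail (V y.1) (W y.1) x.2) y.2.1 y.2.2.
pose q : 'rV[P]_#|{: I}| := \row_a (p (enum_val a : I).1 (enum_val a : I).2 \mPo tau F).
suff /rowP/(_ (enum_rank ((i, j) : I))) : q = 0 by rewrite !mxE enum_rankK.
have sumI (R : nmodType) (G : 'I_3 -> 'I_6 -> R) :
    \sum_(a < #|{: I}|) G (enum_val a : I).1 (enum_val a : I).2 = \sum_i \sum_j G i j.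
  by rewrite pair_bigA /= [RHS]big_enum_val.
have copies e : \sum_i \sum_j (p i j \mPo tau F)
    *: (V e ^+ i * word_tail (V e) (W e) j) = 0.
  rewrite /V /W; case: (e == ord0); first exact: p0.
  transitivity (map_mx transpose_poly (\sum_i \sum_j
    (p i j \mPo tau F) *: (X ^+ i * word_tail X Y j))); last by rewrite p0 map_mx0.
  rewrite raddf_sum; apply: eq_bigr => i' _.
  rewrite raddf_sum; apply: eq_bigr => j' _ /=.
  rewrite map_mxZ transpose_tau (map_mx_word _ _ _ _ (ltn_ord j')).
  by rewrite (transpose_gen_mx ord0) (transpose_gen_mx ord_max).
apply: (row_free_specialization (v := base_point F) (J := J)); last first.
  apply/rowP => b; rewrite [LHS]mxE [RHS]mxE.
  case yE: (enum_val b : E) => [e [s t]].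
  transitivity ((\sum_i \sum_j (p i j \mPo tau F)
    *: (V e ^+ i * word_tail (V e) (W e) j)) s t); last by rewrite copies mxE.
  rewrite summxE -[LHS](_ : \sum_i \sum_j (p i j \mPo tau F)
    * (V e ^+ i * word_tail (V e) (W e) j) s t = _).
    apply: eq_bigr => i' _; rewrite summxE; apply: eq_bigr => j' _.
    by rewrite [RHS]mxE.
  rewrite -(sumI _ (fun i j => _)); apply: eq_bigr => a _.
  by rewrite [q _ _]mxE [J _ _]mxE yE.
apply: inj_row_free => c cJ; pose c' i j := c 0 (enum_rank ((i, j) : I)).
suff c0 i' j' : c' i' j' = 0.
  by apply/rowP => a; rewrite mxE -[a]enum_valK; case: (enum_val a) => i' j'; apply: c0.
apply: (words_free_at_point charF0) => e e1.
pose k : 'I_2 := if e == 1 then ord0 else ord_max.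
apply/matrixP => s t; rewrite [RHS]mxE.
have := congr1 (fun M : 'rV_#|{: E}| => M 0 (enum_rank ((k, (s, t)) : E))) cJ.
rewrite [X in _ = X -> _]mxE [X in X = _ -> _]mxE => <-.
have evX := @meval_gen_mx F (fun k => if k == ord0 then point_mx F else shift_mx F 1) ord0.
have evY := @meval_gen_mx F (fun k => if k == ord0 then point_mx F else shift_mx F 1) ord_max.
have evV : map_mx (meval (base_point F)) (V k) = point_mx F.
  rewrite /V; case: (k == ord0); first exact: evX.
  rewrite -map_trmx evX; apply/matrixP => x y; rewrite !mxE eq_sym.
  by case: eqP => [->|].
have evW : map_mx (meval (base_point F)) (W k) = shift_mx F e.
  rewrite /W /k; move: e1; rewrite !inE => /orP[]/eqP -> /=; first exact: evY.
  rewrite -map_trmx evY; apply/matrixP => x y; rewrite !mxE.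
  by rewrite -(inj_eq (addIr 1) y) subrK eq_sym.
transitivity (\sum_i \sum_j c' i j
    * (point_mx F ^+ i * word_tail (point_mx F) (shift_mx F e) j) s t).
  rewrite summxE; apply: eq_bigr => x _; rewrite summxE; apply: eq_bigr => z _.
  by rewrite [LHS]mxE.
rewrite -(sumI _ (fun i j => _)); apply: eq_bigr => a _.
rewrite /c' -surjective_pairing enum_valK; congr (_ * _).
rewrite [RHS]mxE [J _ _]mxE enum_rankK /= -evV -evW.
by rewrite -(map_mx_word _ _ _ _ (ltn_ord _)) [LHS]mxE.
Qed.

End Free.

(** * The mixed trace algebra lies in the span *)

Section Spanning.
Variable F : fieldType.
Hypothesis charF0 : [pchar F] =i pred0.
Notation P := {mpoly F[2 * (3 * 3)]}.
Notation X := (gen_mx F ord0).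
Notation Y := (gen_mx F ord_max).

Definition trace_subring (p : P) : Prop := exists q, p = q \mPo tau F.
Notation Q := trace_subring.
Notation S := (module_span X Y Q).

Let QC c : Q c%:MP. Proof. by exists c%:MP; rewrite comp_mpolyC. Qed.
Let Q1 : Q 1. Proof. exact: (QC 1). Qed.
Let QB a b : Q a -> Q b -> Q (a - b).
Proof. by move=> [p ->] [q ->]; exists (p - q); rewrite comp_mpolyB. Qed.
Let QM a b : Q a -> Q b -> Q (a * b).
Proof. by move=> [p ->] [q ->]; exists (p * q); rewrite rmorphM. Qed.

Let natC n : (n.+1%:R : P) = (n.+1%:R : F)%:MP.
Proof. by rewrite rmorph_nat. Qed.

Let unit_nat n : (n.+1%:R : P) \is a GRing.unit.
Proof.
apply/unitrP; exists (n.+1%:R^-1 : F)%:MP; rewrite natC -!mpolyCM.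
have nz : (n.+1%:R : F) != 0 by rewrite (pcharf0P _).1.
by rewrite mulVf // mulfV.
Qed.

Let QVn n : Q n.+1%:R^-1.
Proof.
have -> : (n.+1%:R : P)^-1 = (n.+1%:R^-1 : F)%:MP; last exact: QC.
apply: (mulrI (unit_nat n)); rewrite mulrV ?unit_nat // natC -mpolyCM mulfV //.
by rewrite (pcharf0P _).1.
Qed.

Let Qtau k : (k < 10)%N -> Q (trace_gen X Y k).
Proof.
by move=> lt_k; exists 'X_(Ordinal lt_k); rewrite comp_mpolyXU -tnth_nth tnth_mktuple.
Qed.

Let QX1 : Q (\tr X).
Proof. by have := @Qtau 0 isT; rewrite /trace_gen /= mulr1. Qed.
Let QX2 : Q (\tr (X * X)).
Proof. by have := @Qtau 1 isT; rewrite /trace_gen /= mulr1 expr2. Qed.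
Let QX3 : Q (\tr (X * X * X)).
Proof. by have := @Qtau 2 isT; rewrite /trace_gen /= mulr1 !exprS expr0 mulr1 mulrA. Qed.
Let QY1 : Q (\tr Y).
Proof. by have := @Qtau 3 isT; rewrite /trace_gen /= mul1r. Qed.
Let QXY : Q (\tr (X * Y)). Proof. exact: (@Qtau 4 isT). Qed.
Let QXXY : Q (\tr (X * X * Y)).
Proof. by have := @Qtau 5 isT; rewrite /trace_gen /= expr2. Qed.
Let QY2 : Q (\tr (Y * Y)).
Proof. by have := @Qtau 6 isT; rewrite /trace_gen /= mul1r expr2. Qed.
Let QXYY : Q (\tr (X * Y * Y)).
Proof. by have := @Qtau 7 isT; rewrite /trace_gen /= expr2 mulrA. Qed.
Let QXXYY : Q (\tr (X * X * Y * Y)).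
Proof. by have := @Qtau 8 isT; rewrite /trace_gen /= !expr2 mulrA. Qed.
Let QY3 : Q (\tr (Y * Y * Y)).
Proof. by have := @Qtau 9 isT; rewrite /trace_gen /= mul1r !exprS expr0 mulr1 mulrA. Qed.

Let SM := module_spanM Q1 QB QM (unit_nat 1) (QVn 1) (unit_nat 2) (QVn 2)
  QX1 QX2 QX3 QY1 QY2 QY3 QXY QXXY QXYY QXXYY.
Let Str := module_span_trace Q1 QB QM (unit_nat 1) (QVn 1) (unit_nat 2) (QVn 2)
  QX1 QX2 QX3 QY1 QY2 QY3 QXY QXXY QXYY QXXYY.
Let SD := @module_spanD _ X Y _ Q1 QB.
Let SZ := @module_spanZ _ X Y _ QM.

Let S1 : S 1.
Proof. by have := module_span_gen X Y Q1 QB (i := 0) (j := 0) isT isT; rewrite mulr1. Qed.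

Let Sgen k : S (gen_mx F k).
Proof.
have -> : k = if k == ord0 then ord0 else ord_max by case: k => [[|[|]]] // ?; apply: val_inj.
case: (k == ord0).
  by have := module_span_gen X Y Q1 QB (i := 1) (j := 0) isT isT; rewrite mulr1 expr1.
by have := module_span_gen X Y Q1 QB (i := 0) (j := 1) isT isT; rewrite mul1r.
Qed.

Let Sconst c : S (mx_const c).
Proof. by rewrite /mx_const -scalemx1; apply: SZ. Qed.

Let Spure p : pure_trace p -> S p%:M.
Proof.
elim=> [a [w _ ->]|c|a b _ Sa _ Sb|a b _ Sa _ Sb].
- rewrite -scalemx1; apply: Str; rewrite /word_mx; elim: w => [|k w IH].
    by rewrite big_nil.
  by rewrite big_cons; apply: SM.
- exact: Sconst.
- by rewrite raddfD; apply: SD.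
- by rewrite scalar_mxM mulmxE; apply: SM.
Qed.

Lemma mixed_trace_span A : mixed_trace A -> S A.
Proof.
elim=> [{}A [|[p /Spure Sp -> //]]|c||]; [|exact: Sconst| |].
- elim=> [{}A [k ->] //|c|B C _ SB _ SC|B C _ SB _ SC].
  + exact: Sconst.
  + exact: SD.
  + exact: SM.
- by move=> B C _ SB _ SC; apply: SD.
- by move=> B C _ SB _ SC; apply: SM.
Qed.

End Spanning.

(** * Multidegrees *)

Lemma trace_exp_gt0 k : (k < 10)%N -> (0 < (trace_exp k).1 + (trace_exp k).2)%N.
Proof. by case: k => [|[|[|[|[|[|[|[|[|[|//]]]]]]]]]]. Qed.

Section Grading.
Variable F : fieldType.
Notation P := {mpoly F[2 * (3 * 3)]}.
Notation X := (gen_mx F ord0).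
Notation Y := (gen_mx F ord_max).

Lemma mnm_degD k m1 m2 : mnm_deg k (m1 + m2)%MM = (mnm_deg k m1 + mnm_deg k m2)%N.
Proof.
rewrite /mnm_deg -big_split; apply: eq_bigr => i _; rewrite -big_split.
by apply: eq_bigr => j _; rewrite mnmDE.
Qed.

Lemma multihomogC c : multihomog 0 0 (c%:MP : P).
Proof.
move=> m; rewrite msuppC; case: (c == 0) => //; rewrite inE => /eqP ->.
by split; rewrite /mnm_deg big1 // => i _; rewrite big1 // => j _; rewrite mnm0E.
Qed.

Lemma multihomogM k1 k2 l1 l2 (p q : P) : multihomog k1 k2 p -> multihomog l1 l2 q ->
  multihomog (k1 + l1) (k2 + l2) (p * q).
Proof.
move=> hp hq m /msuppM_le/allpairsP[[m1 m2] /= [/hp[<- <-] /hq[<- <-] ->]].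
by rewrite !mnm_degD.
Qed.

Lemma multihomogD k1 k2 (p q : P) : multihomog k1 k2 p -> multihomog k1 k2 q ->
  multihomog k1 k2 (p + q).
Proof. by move=> hp hq m /msuppD_le; rewrite mem_cat => /orP[/hp|/hq]. Qed.

Lemma multihomog_sum k1 k2 (I : finType) (G : I -> P) :
  (forall i, multihomog k1 k2 (G i)) -> multihomog k1 k2 (\sum_i G i).
Proof.
move=> hG; elim/big_ind: _ => [m|p q|i _]; [|exact: multihomogD|exact: hG].
by rewrite msupp0.
Qed.

Lemma multihomog1 : multihomog 0 0 (1 : P). Proof. by rewrite -mpolyC1; apply: multihomogC. Qed.

Lemma multihomogX k1 k2 n (p : P) : multihomog k1 k2 p ->
  multihomog (n * k1) (n * k2) (p ^+ n).
Proof.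
move=> hp; elim: n => [|n IH]; first exact: multihomog1.
by rewrite exprS !mulSn; apply: multihomogM.
Qed.

Definition multihomog_mx k1 k2 (A : 'M[P]_3) := forall i j, multihomog k1 k2 (A i j).

Lemma multihomog_mxM k1 k2 l1 l2 A B : multihomog_mx k1 k2 A ->
  multihomog_mx l1 l2 B -> multihomog_mx (k1 + l1) (k2 + l2) (A * B).
Proof.
move=> hA hB i j; rewrite -mulmxE mxE; apply: multihomog_sum => k.
exact: multihomogM.
Qed.

Lemma multihomog_mx1 : multihomog_mx 0 0 1.
Proof.
by move=> i j; rewrite mxE; case: (i == j); [apply: multihomog1|move=> m; rewrite msupp0].
Qed.

Lemma multihomog_mxX k1 k2 n A : multihomog_mx k1 k2 A ->
  multihomog_mx (n * k1) (n * k2) (A ^+ n).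
Proof.
move=> hA; elim: n => [|n IH]; first exact: multihomog_mx1.
by rewrite exprS !mulSn; apply: multihomog_mxM.
Qed.

Lemma multihomog_tr k1 k2 A : multihomog_mx k1 k2 A -> multihomog k1 k2 (\tr A).
Proof. by move=> hA; apply: multihomog_sum => i; apply: hA. Qed.

Lemma multihomog_gen_mx (k : 'I_2) :
  multihomog_mx (k == ord0) (k == ord_max) (gen_mx F k).
Proof.
have dE k' i j : mnm_deg k' U_(gvar k i j) = (k == k').
  rewrite /mnm_deg (bigD1 i) //= (bigD1 j) //= mnm1E gvar_inj !eqxx !andbT.
  rewrite !big1 ?addn0 // => [i' /negPf ii'|j' /negPf jj'].
    by rewrite big1 // => j' _; rewrite mnm1E gvar_inj eq_sym [i == _]eq_sym ii' andbF.
  by rewrite mnm1E gvar_inj [j == _]eq_sym jj' !andbF.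
by move=> i j m; rewrite mxE msuppX inE => /eqP ->; rewrite !dE.
Qed.

Let hX : multihomog_mx 1 0 X := @multihomog_gen_mx ord0.
Let hY : multihomog_mx 0 1 Y := @multihomog_gen_mx ord_max.

Lemma multihomog_trace_gen k :
  multihomog (trace_exp k).1 (trace_exp k).2 (trace_gen X Y k).
Proof.
rewrite /trace_gen; move: (trace_exp k) => [a b] /=.
have := multihomog_mxM (multihomog_mxX (n := a) hX) (multihomog_mxX (n := b) hY).
by rewrite !muln0 !muln1 addn0 => /multihomog_tr.
Qed.

Definition tail_deg (j : nat) : nat * nat :=
  nth (0, 0)%N [:: (0, 0); (0, 1); (0, 2); (1, 1); (1, 2); (1, 3)]%N j.

Lemma multihomog_word i j : (j < 6)%N ->
  multihomog_mx (i + (tail_deg j).1) (tail_deg j).2 (X ^+ i * word_tail X Y j).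
Proof.
move=> lt_j; have := multihomog_mxX (n := i) hX; rewrite muln0 muln1 => hXi.
rewrite -[X in multihomog_mx _ X]add0n; apply: multihomog_mxM => // {hXi}.
have hYY := multihomog_mxM hY hY; have hYX := multihomog_mxM hY hX.
have hYXY := multihomog_mxM hYX hY; have hYXYY := multihomog_mxM hYXY hY.
case: j lt_j => [|[|[|[|[|[|//]]]]]] _.
- exact: multihomog_mx1.
- exact: hY.
- exact: hYY.
- exact: hYX.
- exact: hYXY.
- exact: hYXYY.
Qed.

Definition basis_elt (m : 'X_{1..10}) (x : 'I_3 * 'I_6) : 'M[P]_3 :=
  ('X_[m] \mPo tau F) *: (X ^+ x.1 * word_tail X Y x.2).

Definition basis_deg (m : 'X_{1..10}) (x : 'I_3 * 'I_6) : nat * nat :=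
  (\sum_(k < 10) m k * (trace_exp k).1 + (x.1 + (tail_deg x.2).1),
   \sum_(k < 10) m k * (trace_exp k).2 + (tail_deg x.2).2)%N.

Lemma multihomog_basis m x :
  multihomog_mx (basis_deg m x).1 (basis_deg m x).2 (basis_elt m x).
Proof.
have hm : multihomog (\sum_(k < 10) m k * (trace_exp k).1)
    (\sum_(k < 10) m k * (trace_exp k).2) ('X_[m] \mPo tau F).
  rewrite comp_mpolyX; elim/big_rec3: _ => [|k p d e _ IH]; first exact: multihomog1.
  apply: multihomogM => //; apply: multihomogX; rewrite tnth_mktuple.
  exact: multihomog_trace_gen.
by move=> i j; rewrite mxE; apply: multihomogM => //; apply: multihomog_word.
Qed.

Lemma mixed_trace_basis m x : mixed_trace (basis_elt m x).
Proof.
rewrite /basis_elt -mul_scalar_mx mulmxE; apply: gen_alg_mul; apply: gen_alg_gen.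
  right; exists ('X_[m] \mPo tau F) => //; rewrite comp_mpolyX.
  elim/big_rec: _ => [|k p _ IH]; first exact: (gen_alg_const _ _ 1).
  apply: gen_alg_mul => //; elim: (m k) => [|n IHn].
    by rewrite expr0; apply: (gen_alg_const _ _ 1).
  rewrite exprS; apply: gen_alg_mul => //; apply: gen_alg_gen.
  rewrite tnth_mktuple /trace_gen.
  exists (nseq (trace_exp k).1 ord0 ++ nseq (trace_exp k).2 ord_max).
    by rewrite -size_eq0 size_cat !size_nseq -lt0n trace_exp_gt0.
  by rewrite /word_mx big_cat /= !big_nseq !iter_mulr_1.
have gX : generic_alg X by apply: gen_alg_gen; exists ord0.
have gY : generic_alg Y by apply: gen_alg_gen; exists ord_max.
have g1 : generic_alg (1 : 'M[P]_3).
  by have := gen_alg_const (@mx_const F) (fun A => exists k, A = gen_mx F k) 1.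
left; apply: gen_alg_mul.
  by elim: (x.1 : nat) => [|n IHn]; rewrite ?expr0 // exprS; apply: gen_alg_mul.
case: x.2 => [[|[|[|[|[|[|//]]]]]] ?]; rewrite /word_tail /= //;
  by do ?apply: gen_alg_mul.
Qed.

End Grading.

(** * Dimensions of the multihomogeneous components *)

Section Dimension.
Variable F : fieldType.
Notation P := {mpoly F[2 * (3 * 3)]}.

Lemma has_dim_uniq (V : 'M[P]_3 -> Prop) n m : has_dim V n -> has_dim V m -> n = m.
Proof.
have express n' m' (e : 'I_n' -> 'M[P]_3) (d : 'I_m' -> 'M[P]_3) :
    (forall i, V (e i)) ->
    (forall A, V A -> exists c : 'I_m' -> F, A = \sum_i (c i)%:MP *: d i) ->
    exists N : 'M[F]_(n', m'), forall i, e i = \sum_j (N i j)%:MP *: d j.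
  move=> Ve spand; have /choice[N NE] i := spand _ (Ve i).
  by exists (\matrix_(i, j) N i j) => i; rewrite NE; apply: eq_bigr => j _; rewrite mxE.
have leq n' m' : has_dim V n' -> has_dim V m' -> (n' <= m')%N.
  move=> [e [Ve freee spane]] [d [Vd _ spand]].
  have [N NE] := express _ _ _ _ Ve spand; have [M ME] := express _ _ _ _ Vd spane.
  apply: (@mulmx1_min _ _ _ N M); apply/matrixP => i k; apply/eqP; rewrite -subr_eq0.
  apply/eqP; apply: (freee (fun k => (N *m M) i k - 1%:M i k) _ k) => {k}.
  under eq_bigr do rewrite mpolyCB scalerBl; rewrite sumrB.
  rewrite [X in _ - X](bigD1 i) //= [X in _ - (_ + X)]big1 ?addr0; last first.
    by move=> j /negPf ij; rewrite mxE eq_sym ij mpolyC0 scale0r.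
  rewrite mxE eqxx mpolyC1 scale1r; apply/eqP; rewrite subr_eq0; apply/eqP.
  rewrite [RHS]NE; under [RHS]eq_bigr do rewrite ME scaler_sumr.
  rewrite exchange_big /=; apply: eq_bigr => j _; rewrite mxE raddf_sum scaler_suml.
  by apply: eq_bigr => l _; rewrite /= mpolyCM scalerA.
by move=> hn hm; apply/eqP; rewrite eqn_leq !leq.
Qed.

Lemma dimF_eq (V : 'M[P]_3 -> Prop) n : has_dim V n -> dimF V = n.
Proof.
move=> hn; rewrite /dimF; case: pselect => [ex|[]]; last by exists n.
by case: (cid ex) => m /= hm; apply: has_dim_uniq hm hn.
Qed.

End Dimension.

Section Component.
Variable F : fieldType.
Hypothesis charF0 : [pchar F] =i pred0.
Notation P := {mpoly F[2 * (3 * 3)]}.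
Notation X := (gen_mx F ord0).
Notation Y := (gen_mx F ord_max).

Definition bounded_mnm N (a : {ffun 'I_10 -> 'I_N.+1}) : 'X_{1..10} :=
  [multinom (a i : nat) | i < 10].

Lemma bounded_mnm_inj N : injective (@bounded_mnm N).
Proof.
move=> a b /mnmP ab; apply/ffunP => i; apply: val_inj.
by have := ab i; rewrite !mnmE.
Qed.

(** Only exponents at most N can contribute, so a sum over a support becomes a sum
    over a finite type that depends on the degree alone. *)
Lemma sum_bounded_mnm N (V : nmodType) (s : seq 'X_{1..10}) (D : pred 'X_{1..10})
    (G : 'X_{1..10} -> V) :
  uniq s -> (forall m, m \notin s -> G m = 0) ->
  (forall m, D m -> forall i, (m i <= N)%N) ->
  \sum_(m <- s | D m) G m
  = \sum_(a : {ffun 'I_10 -> 'I_N.+1} | D (bounded_mnm a)) G (bounded_mnm a).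
Proof.
move=> uniq_s Gs DN; pose L := [seq @bounded_mnm N a | a <- enum {: {ffun 'I_10 -> 'I_N.+1}}].
have -> : \sum_(a : {ffun 'I_10 -> 'I_N.+1} | D (bounded_mnm a)) G (bounded_mnm a)
    = \sum_(m <- L | D m) G m by rewrite big_map big_enum_cond.
rewrite [RHS](bigID (mem s)) /= [X in _ + X]big1 ?addr0; last first.
  by move=> m /andP[_ /Gs].
rewrite -big_filter -[RHS]big_filter; apply: perm_big; apply: uniq_perm.
- exact: filter_uniq.
- by apply: filter_uniq; rewrite map_inj_uniq ?enum_uniq //; apply: bounded_mnm_inj.
move=> m; rewrite !mem_filter; case Dm: (D m) => //=; case: (m \in s) => //=.
apply/esym/mapP; exists [ffun i => inord (m i)]; first by rewrite mem_enum.
by apply/mnmP => i; rewrite mnmE ffunE inordK // ltnS DN.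
Qed.

Definition basis_index k1 k2 : {set ('I_3 * 'I_6) * {ffun 'I_10 -> 'I_(k1 + k2).+1}} :=
  [set y | basis_deg (bounded_mnm y.2) y.1 == (k1, k2)].

Let basis_deg_bound k1 k2 m x : basis_deg m x == (k1, k2) ->
  forall i, (m i <= k1 + k2)%N.
Proof.
move=> /eqP[<- <-] i.
have le (c : 'I_10 -> nat) : (m i * c i <= \sum_(k < 10) m k * c k)%N.
  by rewrite (bigD1 i) //= leq_addr.
have := le (fun k => (trace_exp k).1); have := le (fun k => (trace_exp k).2).
have := leq_pmulr (m i) (trace_exp_gt0 (ltn_ord i)); rewrite mulnDr.
by move: (\sum_(k < 10) _)%N (\sum_(k < 10) _)%N => /= s t; lia.
Qed.

Lemma words_sum (q : 'I_3 -> 'I_6 -> {mpoly F[10]}) :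
  \sum_i \sum_j (q i j \mPo tau F) *: (X ^+ i * word_tail X Y j)
  = \sum_(x : 'I_3 * 'I_6) \sum_(m <- msupp (q x.1 x.2))
      ((q x.1 x.2)@_m)%:MP *: basis_elt F m x.
Proof.
rewrite pair_bigA; apply: eq_bigr => x _ /=.
rewrite comp_mpolyEX scaler_suml; apply: eq_bigr => m _.
by rewrite /basis_elt scalerA mul_mpolyC.
Qed.

(** Each product of a monomial in the ten traces with a word is multihomogeneous,
    so the expansion of a multihomogeneous element only needs the products of the
    same multidegree. *)
Lemma mixed_trace_comp_dim k1 k2 :
  has_dim (@mixed_trace_comp F k1 k2) #|basis_index k1 k2|.
Proof.
set K := basis_index k1 k2.
pose elt (y : ('I_3 * 'I_6) * {ffun 'I_10 -> 'I_(k1 + k2).+1}) :=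
  basis_elt F (bounded_mnm y.2) y.1.
have sumK (V : nmodType) (G : ('I_3 * 'I_6) * {ffun 'I_10 -> 'I_(k1 + k2).+1} -> V) :
    \sum_(y in K) G y = \sum_x \sum_(a | (x, a) \in K) G (x, a).
  by rewrite pair_big_dep; apply: eq_big => -[].
exists (fun n => elt (enum_val n)); split.
- move=> n; have := enum_valP n; rewrite inE => /eqP deg_n.
  split; first exact: mixed_trace_basis.
  have := @multihomog_basis F (bounded_mnm (enum_val n).2) (enum_val n).1.
  by rewrite deg_n.
- move=> c c0 n; pose c' y := c (enum_rank_in (enum_valP n) y).
  pose q i j := \sum_(a | ((i, j), a) \in K) c' ((i, j), a) *: 'X_[bounded_mnm a].
  have q0 i j : q i j = 0.
    apply: (words_free charF0 (p := q)).
    transitivity (\sum_(y in K) (c' y)%:MP *: elt y); last first.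
      rewrite big_enum_val -[RHS]c0; apply: eq_bigr => l _.
      by rewrite /c' enum_valK_in.
    rewrite pair_bigA sumK; apply: eq_bigr => -[i' j'] _ /=.
    rewrite /q raddf_sum scaler_suml; apply: eq_bigr => a _ /=.
    by rewrite comp_mpolyZ -mul_mpolyC -scalerA.
  have := congr1 (mcoeff (bounded_mnm (enum_val n).2)) (q0 (enum_val n).1.1 (enum_val n).1.2).
  rewrite mcoeff0 /q raddf_sum /= (bigD1 (enum_val n).2) /=; last first.
    by rewrite -!surjective_pairing enum_valP.
  rewrite big1 ?addr0 => [|a /andP[_ /negPf an]]; last first.
    by rewrite mcoeffZ mcoeffX (inj_eq (@bounded_mnm_inj _)) an mulr0.
  by rewrite mcoeffZ mcoeffX eqxx mulr1 -!surjective_pairing /c' enum_valK_in.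
move=> A [/(mixed_trace_span charF0)[c Qc AE] hA].
have /choice[q' q'E] : forall x : 'I_3 * 'I_6, exists q, c x.1 x.2 = q \mPo tau F.
  by move=> x; apply: Qc.
pose q i j := q' (i, j); have {}q'E i j : c i j = q i j \mPo tau F by rewrite (q'E (i, j)).
pose B := \sum_(y in K) ((q y.1.1 y.1.2)@_(bounded_mnm y.2))%:MP *: elt y.
suff -> : A = B.
  exists (fun n => (q (enum_val n).1.1 (enum_val n).1.2)@_(bounded_mnm (enum_val n).2)).
  by rewrite /B big_enum_val.
pose G m (x : 'I_3 * 'I_6) := ((q x.1 x.2)@_m)%:MP *: basis_elt F m x.
have BE : B = \sum_x \sum_(m <- msupp (q x.1 x.2) | basis_deg m x == (k1, k2)) G m x.
  rewrite /B sumK; apply: eq_bigr => x _.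
  rewrite (@sum_bounded_mnm (k1 + k2)) ?msupp_uniq //.
  - by apply: eq_bigl => a; rewrite inE.
  - by move=> m; rewrite -mcoeff_eq0 /G => /eqP ->; rewrite mpolyC0 scale0r.
  - by move=> m; apply: basis_deg_bound.
have {AE} AE : A = \sum_x \sum_(m <- msupp (q x.1 x.2)) G m x.
  rewrite AE -words_sum; apply: eq_bigr => i _; apply: eq_bigr => j _.
  by rewrite q'E.
pose deg (u : 'X_{1..2 * (3 * 3)}) := (mnm_deg ord0 u, mnm_deg ord_max u).
have coef0 a b (p : P) u : multihomog a b p -> deg u != (a, b) -> p@_u = 0.
  move=> hp /eqP degu; apply/eqP; rewrite mcoeff_eq0; apply/negP => /hp[ua ub].
  by apply: degu; rewrite /deg ua ub.
have G0 m x i j u : deg u != basis_deg m x -> (G m x i j)@_u = 0.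
  by move=> degu; rewrite /G mxE mcoeffCM (coef0 _ _ _ _ (@multihomog_basis F m x i j)) ?mulr0 //.
have sum0 (D : 'I_3 * 'I_6 -> pred 'X_{1..10}) i j u :
    (forall m x, D x m -> deg u != basis_deg m x) ->
    ((\sum_x \sum_(m <- msupp (q x.1 x.2) | D x m) G m x) i j)@_u = 0.
  move=> Du; rewrite summxE raddf_sum big1 // => x _.
  rewrite /= summxE raddf_sum big1 // => m Dxm; apply: G0; exact: Du.
(* C collects the terms of the other multidegrees. *)
pose C := \sum_x \sum_(m <- msupp (q x.1 x.2) | basis_deg m x != (k1, k2)) G m x.
have ABC : A = B + C.
  rewrite AE BE -big_split; apply: eq_bigr => x _.
  by rewrite (bigID (fun m => basis_deg m x == (k1, k2))).
rewrite ABC (_ : C = 0) ?addr0 //; apply/matrixP => i j; rewrite [RHS]mxE.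
apply/mpolyP => u; rewrite mcoeff0; case: (eqVneq (deg u) (k1, k2)) => [degu|degu].
  by apply: sum0 => m x /=; rewrite degu eq_sym.
have CA : C i j = A i j - B i j by rewrite ABC [X in _ = X - _]mxE addrAC subrr add0r.
rewrite CA mcoeffB (coef0 _ _ _ _ (hA i j) degu) BE sum0 ?subr0 // => m x /= /eqP ->.
exact: degu.
Qed.

End Component.

(** * The Hilbert series *)

Section Count.
Variable F : fieldType.
Hypothesis charF0 : [pchar F] =i pred0.
Notation x := (fpsX1 F).
Notation y := (fpsX2 F).

Definition fps_mono (d : nat * nat) : fps2 F := x ^+ d.1 * y ^+ d.2.

Lemma fps_monoX d n : fps_mono d ^+ n = fps_mono (n * d.1, n * d.2)%N.
Proof. by rewrite /fps_mono exprMn -!exprM ![(n * _)%N]mulnC. Qed.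

Lemma fps_mono_prod (I : finType) (d : I -> nat * nat) :
  \prod_i fps_mono (d i) = fps_mono (\sum_i (d i).1, \sum_i (d i).2)%N.
Proof. by rewrite /fps_mono big_split /= !prodrXr. Qed.

(** The factors differ from 1 only in degrees above N. *)
Lemma fps_coef_trunc N (I : finType) (d : I -> nat * nat) (g : fps2 F) a b :
  (forall i, 0 < (d i).1 + (d i).2)%N -> (a + b <= N)%N ->
  (g * \prod_i (1 - fps_mono (d i) ^+ N.+1)) a b = g a b.
Proof.
move=> d0 abN; elim/big_rec: _ g => [|i h _ IH] g; first by rewrite mulr1.
rewrite mulrA IH mulrBr mulr1 fps_monoX [g * _]mulrC.
have subE h1 h2 : (h1 - h2 : fps2 F) a b = h1 a b - h2 a b by [].
rewrite subE fps2_mulX12 ifN ?subr0 //=; apply/negP => /andP[da db].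
by have := leq_pmull N.+1 (d0 i); rewrite mulnDl (mulnC (d i).1) (mulnC (d i).2); lia.
Qed.

Definition tail_poly : fps2 F :=
  \sum_(w : 'I_3 * 'I_6) fps_mono (w.1 + (tail_deg w.2).1, (tail_deg w.2).2)%N.

Lemma basis_count N :
  tail_poly * \prod_(k < 10) \sum_(j < N.+1) fps_mono (trace_exp k) ^+ j
  = \sum_(w : ('I_3 * 'I_6) * {ffun 'I_10 -> 'I_N.+1})
      fps_mono (basis_deg (bounded_mnm w.2) w.1).
Proof.
rewrite bigA_distr_bigA /= /tail_poly mulr_suml.
rewrite -(pair_bigA _ (fun w f => fps_mono (basis_deg (bounded_mnm f) w))) /=.
apply: eq_bigr => w _; rewrite mulr_sumr; apply: eq_bigr => f _.
under eq_bigr do rewrite fps_monoX.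
rewrite fps_mono_prod /fps_mono /basis_deg /= mulrACA -!exprD.
congr (_ ^+ _ * _ ^+ _); rewrite addnC; congr (_ + _)%N; apply: eq_bigr => k _;
  by rewrite mnmE.
Qed.

Lemma hilbert_mixed_traceE a b :
  hilbert_mixed_trace F a b = #|basis_index a b|%:R.
Proof. by rewrite /= (dimF_eq (mixed_trace_comp_dim charF0 a b)). Qed.

Definition trace_den : fps2 F := \prod_(k < 10) (1 - fps_mono (trace_exp k)).

Lemma trace_den_unit : trace_den \is a GRing.unit.
Proof.
rewrite fps2_unitE; have := fps_coef_trunc (N := 0) 1 (a := 0) (b := 0)
  (fun k => trace_exp_gt0 (ltn_ord k)) (leqnn 0).
by rewrite mul1r /trace_den => -> /=; rewrite oner_neq0.
Qed.

(** Up to degree N, dividing by 1 - x^a y^b amounts to multiplying by the geometric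
    sum with N + 1 terms, and the product of these sums enumerates the basis. *)
Lemma hilbert_mixed_trace_den : hilbert_mixed_trace F * trace_den = tail_poly.
Proof.
have U := trace_den_unit; rewrite -[RHS](divrK U); congr (_ * _).
apply: fps2P => a b; rewrite hilbert_mixed_traceE.
pose N := (a + b)%N.
rewrite -(fps_coef_trunc (tail_poly / trace_den)
  (fun k : 'I_10 => trace_exp_gt0 (ltn_ord k)) (leqnn N)).
have -> : \prod_(k < 10) (1 - fps_mono (trace_exp k) ^+ N.+1)
    = trace_den * \prod_(k < 10) \sum_(j < N.+1) fps_mono (trace_exp k) ^+ j.
  rewrite -big_split; apply: eq_bigr => k _ /=.
  by rewrite -opprB subrX1 -mulNr opprB.
rewrite mulrA divrK // basis_count fps_sumE fps_sumE.
rewrite -sum1_card natr_sum big_mkcond; apply: eq_bigr => w _ /=.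
rewrite fps2_X12 inE /basis_deg xpair_eqE.
by rewrite [a == _]eq_sym [b == _]eq_sym; case: (_ && _).
Qed.

Lemma tail_polyE : tail_poly = (1 + x + x ^+ 2) * (1 + y + y ^+ 2) * (1 + x * y).
Proof.
rewrite /tail_poly -(pair_bigA _ (fun (i : 'I_3) (j : 'I_6) =>
  fps_mono (i + (tail_deg j).1, (tail_deg j).2)%N)) /=.
rewrite /fps_mono !(big_ord_recl, big_ord0) /tail_deg /=.
ring.
Qed.

Lemma trace_denE : trace_den = (1 - x) * (1 - x ^+ 2) * (1 - x ^+ 3) * (1 - y)
  * (1 - x * y) * (1 - x ^+ 2 * y) * (1 - y ^+ 2) * (1 - x * y ^+ 2)
  * (1 - x ^+ 2 * y ^+ 2) * (1 - y ^+ 3).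
Proof.
rewrite /trace_den /fps_mono !(big_ord_recl, big_ord0) /trace_exp /=; ring.
Qed.

(** The three factors of [tail_poly] turn 1 - x, 1 - y and 1 - xy into 1 - x^3,
    1 - y^3 and 1 - x^2 y^2. *)
Lemma hilbert_mixed_trace_inv : hilbert_mixed_trace F * hilbert_den x y = 1.
Proof.
apply: (mulIr trace_den_unit); rewrite mulrAC hilbert_mixed_trace_den mul1r.
by rewrite tail_polyE trace_denE /hilbert_den; ring.
Qed.

End Count.

Theorem theorem2 (F : fieldType) (charF0 : [pchar F] =i pred0) :
  let t := fpsX1 F in
  let v := fpsX2 F in
  let M := mult_series (hilbert_mixed_trace F) in
  let h3 := v ^+ 2 * (v ^+ 4 - v ^+ 3 + 3 * v ^+ 2 - v + 1) in
  let h2 := v * (2 * v ^+ 4 - 4 * v ^+ 3 + v ^+ 2 - v - 1) in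
  let h1 := v * (- v ^+ 4 - v ^+ 3 + v ^+ 2 - 4 * v + 2) in
  let h0 := v ^+ 4 - v ^+ 3 + 3 * v ^+ 2 - v + 1 in
  let a3 := 1 / (2 * (1 - v) ^+ 6 * (1 + v) ^+ 2) in
  let a2 := (3 * v ^+ 2 - 2 * v + 1)
            / (2 ^+ 2 * (1 - v) ^+ 7 * (1 + v) ^+ 3) in
  let a1 := (v ^+ 4 - 6 * v ^+ 3 + 14 * v ^+ 2 - 6 * v + 1)
            / (2 ^+ 3 * (1 - v) ^+ 8 * (1 + v) ^+ 4) in
  let b := 1 / (2 ^+ 3 * (1 - v) ^+ 2 * (1 + v) ^+ 4 * (1 + v ^+ 2)) in
  let c := - v ^+ 4 / ((1 - v) ^+ 8 * (1 + v) ^+ 4 * (1 + v ^+ 2)) in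
  M = (h3 * t ^+ 3 + h2 * t ^+ 2 + h1 * t + h0)
      / ((1 - v) ^+ 7 * (1 + v) ^+ 4 * (1 + v ^+ 2)
         * (1 - t) ^+ 3 * (1 + t) * (1 - v * t))
  /\
  M = a3 / (1 - t) ^+ 3 + a2 / (1 - t) ^+ 2 + a1 / (1 - t)
      + b / (1 + t) + c / (1 - v * t).
Proof.
move=> t v M h3 h2 h1 h0 a3 a2 a1 b c.
have ME : M = mult_num t v / mult_den t v.
  exact: mult_series_rational (hilbert_mixed_trace_inv charF0).
split; first exact: ME.
have v0 : v 0%N 0%N = 0 by [].
have t0 : t 0%N 0%N = 0 by [].
rewrite ME; apply: partial_fractions; split; rewrite fps2_unitE;
  rewrite !fps2_coef0E ?t0 ?v0 ?mulr0 ?subr0 ?addr0 ?oner_neq0 //.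
by rewrite -mulr2n (pcharf0P _).1.
Qed.
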